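(* Let $A$ be a Noetherian commutative ring, let $S$ be a commutative $A$-algebra essentially of finite type over $A$, and let $J$ be an ideal of $S$. Let $\widehat S^J$ denote the $J$-adic completion of $S$. Then for every $n\in\mathbb N$ the natural left $\widehat S^J$-module map $$\widehat S^J\otimes_S D^n_A(S)\to D^n_A(\widehat S^J)$$ is an isomorphism, where the tensor product is formed using the left $S$-module structure on $D^n_A(S)$. Moreover, $\widehat S^J\otimes_S D_A(S)\cong D_A(\widehat S^J)$ as rings.
   Context: For a commutative $A$-algebra $S$: $D^0_A(S)=\mathrm{Hom}_S(S,S)$, and for $n\ge1$, $\delta\in\mathrm{Hom}_A(S,S)$ lies in $D^n_A(S)$ iff $[\delta,s]=\delta\circ s-s\circ\delta\in D^{n-1}_A(S)$ for all $s\in S$; $D_A(S)=\bigcup_nD^n_A(S)$ is a ring under composition. The left $S$-module structure is by post-composition with multiplication by elements of $S$. Differential operators are continuous in the $J$-adic topology, and each $\delta\in D^n_A(S)$ extends uniquely to an operator $\widehat\delta\in D^n_A(\widehat S^J)$; the natural map sends $s\otimes\delta$ to $s\widehat\delta$. The ring isomorphism is the one induced by these natural maps in the union over $n$. *)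

(* Defs.v *)
From HB Require Import structures.
From mathcomp Require Import all_boot all_algebra.
From mathcomp Require Import boolp classical_sets functions.

Set Implicit Arguments.
Unset Strict Implicit.
Unset Printing Implicit Defensive.

Import GRing.Theory.
Local Open Scope ring_scope.
Local Open Scope quotient_scope.

(* All rings are [comPzRingType]s, so the zero ring is allowed.  An A-algebra
   is a ring morphism [f : A -> S], since [lalgType] excludes the zero ring. *)

Record ideal (R : comPzRingType) := Ideal {
  ideal_mem :> {pred R};
  ideal0 : 0 \in ideal_mem;
  idealD : {in ideal_mem &, forall x y, x + y \in ideal_mem};
  idealMl : forall a, {in ideal_mem, forall x, a * x \in ideal_mem} }.

Section Ideals.
Variable R : comPzRingType.
Implicit Types (I J : ideal R).

Lemma ideal_zmod_closed I : zmod_closed (ideal_mem I).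
Proof.
split=> [|x y xI yI]; first exact: ideal0.
by apply: idealD => //; rewrite -mulN1r; apply: idealMl.
Qed.

HB.instance Definition _ I :=
  GRing.isZmodClosed.Build R (ideal_mem I) (ideal_zmod_closed I).

Definition ideal_full : ideal R :=
  @Ideal R predT isT (fun _ _ _ _ => isT) (fun _ _ _ => isT).

Definition ideal_mul_pred I J : {pred R} := fun x =>
  `[< exists2 s : seq (R * R),
        all (fun p => (p.1 \in I) && (p.2 \in J)) s
        & x = \sum_(p <- s) p.1 * p.2 >].

Lemma ideal_mul_proof0 I J : 0 \in ideal_mul_pred I J.
Proof. by apply/asboolP; exists [::]; rewrite ?big_nil. Qed.

Lemma ideal_mul_proofD I J :
  {in ideal_mul_pred I J &, forall x y, x + y \in ideal_mul_pred I J}.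
Proof.
move=> _ _ /asboolP[s sP ->] /asboolP[t tP ->].
by apply/asboolP; exists (s ++ t); rewrite ?all_cat ?sP ?big_cat.
Qed.

Lemma ideal_mul_proofM I J a :
  {in ideal_mul_pred I J, forall x, a * x \in ideal_mul_pred I J}.
Proof.
move=> _ /asboolP[s sP ->]; apply/asboolP.
exists [seq (a * p.1, p.2) | p <- s].
  rewrite all_map; apply: sub_all sP => p /= /andP[p1 p2].
  by rewrite p2 andbT idealMl.
by rewrite big_map mulr_sumr; apply: eq_bigr => p _; rewrite mulrA.
Qed.

Definition ideal_mul I J : ideal R :=
  Ideal (@ideal_mul_proof0 I J) (@ideal_mul_proofD I J) (@ideal_mul_proofM I J).

Fixpoint ideal_pow J (k : nat) : ideal R :=
  if k is k'.+1 then ideal_mul J (ideal_pow J k') else ideal_full.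

Lemma ideal_powS J k : {subset ideal_pow J k.+1 <= ideal_pow J k}.
Proof.
move=> _ /asboolP[s sP ->]; rewrite big_seq; apply: rpred_sum => p ps.
by case/andP: (allP sP p ps) => _; apply: idealMl.
Qed.

Lemma ideal_pow_le J k m :
  (k <= m)%N -> {subset ideal_pow J m <= ideal_pow J k}.
Proof.
move=> /subnK <-; elim: (m - k)%N => [|i IH] x //=.
by move=> /ideal_powS /IH.
Qed.

End Ideals.

Definition finitely_generated_ideal (R : comPzRingType) (I : ideal R) : Prop :=
  exists g : seq R, forall x : R,
    x \in I <-> exists a : nat -> R, x = \sum_(i < size g) a i * g`_i.

Definition noetherian (R : comPzRingType) : Prop :=
  forall I : ideal R, finitely_generated_ideal I.

(* B is its only A-subalgebra containing the generators. *)
Definition finite_type (A B : comPzRingType) (g : {rmorphism A -> B}) : Prop :=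
  exists gens : seq B, forall P : B -> Prop,
    (forall a, P (g a)) -> (forall b, b \in gens -> P b) ->
    (forall x y, P x -> P y -> P (x + y)) ->
    (forall x y, P x -> P y -> P (x * y)) ->
    forall b, P b.

Definition multiplicative (B : comPzRingType) (M : B -> Prop) : Prop :=
  M 1 /\ forall x y, M x -> M y -> M (x * y).

Definition is_localization (B S : comPzRingType) (M : B -> Prop)
    (h : {rmorphism B -> S}) : Prop :=
  [/\ forall m, M m -> exists u, u * h m = 1,
      forall s, exists b m, M m /\ s * h m = h b
    & forall b, h b = 0 -> exists2 m, M m & m * b = 0].

Definition ess_finite_type (A S : comPzRingType) (f : {rmorphism A -> S}) :
    Prop :=
  exists (B : comPzRingType) (g : {rmorphism A -> B}) (h : {rmorphism B -> S})
         (M : B -> Prop),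
    [/\ finite_type g, multiplicative M, is_localization M h
      & forall a, f a = h (g a)].

(* The ring structure that the library puts on [Quotient.quot] requires a
   proper ideal, so only its additive structure is reused. *)
Section QuotientRing.
Variables (R : comPzRingType) (I : ideal R).

Definition quo : Type := Quotient.quot (ideal_mem I).
HB.instance Definition _ := GRing.Zmodule.on quo.

Definition toquo (x : R) : quo := \pi_(Quotient.quot (ideal_mem I)) x.

Lemma toquo_surj (q : quo) : exists x, q = toquo x.
Proof. by exists (repr (q : Quotient.quot _)); rewrite /toquo reprK. Qed.

Lemma toquoP x y : toquo x = toquo y <-> x - y \in I.
Proof.
by rewrite /toquo; split=> [/eqP|H]; [|apply/eqP];
  rewrite -Quotient.idealrBE.
Qed.

Lemma toquo_is_zmod_morphism : zmod_morphism toquo.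
Proof. exact: (@raddfB _ _ (\pi_(Quotient.quot (ideal_mem I)))). Qed.

Definition quo_mul (p q : quo) : quo :=
  toquo (repr (p : Quotient.quot _) * repr (q : Quotient.quot _)).

Lemma quo_mulE x y : quo_mul (toquo x) (toquo y) = toquo (x * y).
Proof.
rewrite /quo_mul; set x' := repr _; set y' := repr _.
have xx' : x' - x \in I by apply/toquoP; rewrite /toquo reprK.
have yy' : y' - y \in I by apply/toquoP; rewrite /toquo reprK.
apply/toquoP; rewrite -[x' * y'](subrK (x' * y)) -addrA -mulrBr -mulrBl.
by apply: idealD; rewrite ?[(x' - x) * y]mulrC; apply: idealMl.
Qed.

Lemma quo_mulA : associative quo_mul.
Proof.
move=> p q r; have [x ->] := toquo_surj p; have [y ->] := toquo_surj q.
by have [z ->] := toquo_surj r; rewrite !quo_mulE mulrA.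
Qed.

Lemma quo_mulC : commutative quo_mul.
Proof.
move=> p q; have [x ->] := toquo_surj p; have [y ->] := toquo_surj q.
by rewrite !quo_mulE mulrC.
Qed.

Lemma quo_mul1 : left_id (toquo 1) quo_mul.
Proof. by move=> p; have [x ->] := toquo_surj p; rewrite quo_mulE mul1r. Qed.

Lemma toquoD x y : toquo (x + y) = toquo x + toquo y.
Proof. exact: (@raddfD _ _ (\pi_(Quotient.quot (ideal_mem I)))). Qed.

Lemma quo_mulDl : left_distributive quo_mul +%R.
Proof.
move=> p q r; have [x ->] := toquo_surj p; have [y ->] := toquo_surj q.
by have [z ->] := toquo_surj r; rewrite -toquoD !quo_mulE mulrDl toquoD.
Qed.

HB.instance Definition _ :=
  GRing.Zmodule_isComPzRing.Build quo quo_mulA quo_mulC quo_mul1 quo_mulDl.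

Lemma toquo_is_monoid_morphism : monoid_morphism toquo.
Proof. by split=> // x y; rewrite -quo_mulE. Qed.

HB.instance Definition _ :=
  GRing.isZmodMorphism.Build R quo toquo toquo_is_zmod_morphism.
HB.instance Definition _ :=
  GRing.isMonoidMorphism.Build R quo toquo toquo_is_monoid_morphism.

End QuotientRing.

(* The completion is the inverse limit of the rings S / J^k, with J^0 = S. *)
Section Completion.
Variables (S : comPzRingType) (J : ideal S).

Definition quo_transition k (q : quo (ideal_pow J k.+1)) :
    quo (ideal_pow J k) :=
  toquo _ (repr (q : Quotient.quot _)).

Lemma quo_transitionE k s :
  quo_transition (toquo (ideal_pow J k.+1) s) = toquo (ideal_pow J k) s.
Proof.
by apply/toquoP/ideal_powS/toquoP; rewrite /toquo reprK.
Qed.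

Record completion := Completion {
  compl_proj :> forall k, quo (ideal_pow J k);
  compl_compat : `[< forall k,
    quo_transition (compl_proj k.+1) = compl_proj k >] }.

HB.instance Definition _ := [isSub for compl_proj].
HB.instance Definition _ := [Choice of completion by <:].

Lemma compl_ext (x y : completion) : (forall k, x k = y k) -> x = y.
Proof. by move=> xy; apply/val_inj/functional_extensionality_dep. Qed.

Lemma compl_approx (x : completion) k :
  exists s, forall i, (i <= k)%N -> x i = toquo _ s.
Proof.
elim: k => [|k [s IH]].
  by have [s xs] := toquo_surj (x 0%N); exists s => -[].
have [t xt] := toquo_surj (x k.+1); exists t => i.
have xkt : x k = toquo _ t.
  by have /asboolP/(_ k) <- := compl_compat x; rewrite xt quo_transitionE.
rewrite leq_eqVlt => /predU1P[-> //|ik]; rewrite IH //.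
apply/toquoP/(ideal_pow_le (k := i) (m := k)) => //.
by apply/toquoP; rewrite -IH.
Qed.

Definition compl_lift0 (op : forall k, quo (ideal_pow J k))
    (opP : forall k, exists s, forall i, (i <= k)%N -> op i = toquo _ s) :
  completion.
Proof.
exists op; apply/asboolP => k; have [s os] := opP k.+1.
by rewrite !os // quo_transitionE.
Defined.

Definition compl_of (s : S) : completion.
Proof. by apply: (@compl_lift0 (fun k => toquo _ s)) => k; exists s. Defined.

Definition compl_opp (x : completion) : completion.
Proof.
apply: (@compl_lift0 (fun k => - x k)) => k.
have [s xs] := compl_approx x k.
by exists (- s) => i /xs->; rewrite rmorphN.
Defined.

Definition compl_add (x y : completion) : completion.
Proof.
apply: (@compl_lift0 (fun k => x k + y k)) => k.
have [s xs] := compl_approx x k; have [t yt] := compl_approx y k.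
by exists (s + t) => i ik; rewrite xs // yt // rmorphD.
Defined.

Definition compl_mul (x y : completion) : completion.
Proof.
apply: (@compl_lift0 (fun k => x k * y k)) => k.
have [s xs] := compl_approx x k; have [t yt] := compl_approx y k.
by exists (s * t) => i ik; rewrite xs // yt // rmorphM.
Defined.

Lemma compl_addA : associative compl_add.
Proof. by move=> x y z; apply: compl_ext => k; apply: addrA. Qed.
Lemma compl_addC : commutative compl_add.
Proof. by move=> x y; apply: compl_ext => k; apply: addrC. Qed.
Lemma compl_add0 : left_id (compl_of 0) compl_add.
Proof. by move=> x; apply: compl_ext => k /=; rewrite rmorph0 add0r. Qed.
Lemma compl_addN : left_inverse (compl_of 0) compl_opp compl_add.
Proof. by move=> x; apply: compl_ext => k /=; rewrite rmorph0 addNr. Qed.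

HB.instance Definition _ := GRing.isZmodule.Build completion
  compl_addA compl_addC compl_add0 compl_addN.

Lemma compl_mulA : associative compl_mul.
Proof. by move=> x y z; apply: compl_ext => k; apply: mulrA. Qed.
Lemma compl_mulC : commutative compl_mul.
Proof. by move=> x y; apply: compl_ext => k; apply: mulrC. Qed.
Lemma compl_mul1 : left_id (compl_of 1) compl_mul.
Proof. by move=> x; apply: compl_ext => k /=; rewrite rmorph1 mul1r. Qed.
Lemma compl_mulDl : left_distributive compl_mul +%R.
Proof. by move=> x y z; apply: compl_ext => k; apply: mulrDl. Qed.

HB.instance Definition _ := GRing.Zmodule_isComPzRing.Build completion
  compl_mulA compl_mulC compl_mul1 compl_mulDl.

Lemma compl_of_is_zmod_morphism : zmod_morphism compl_of.
Proof. by move=> x y; apply: compl_ext => k /=; rewrite rmorphB. Qed.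
Lemma compl_of_is_monoid_morphism : monoid_morphism compl_of.
Proof. by split=> // x y; apply: compl_ext => k /=; rewrite rmorphM. Qed.

HB.instance Definition _ :=
  GRing.isZmodMorphism.Build S completion compl_of compl_of_is_zmod_morphism.
HB.instance Definition _ := GRing.isMonoidMorphism.Build S completion compl_of
  compl_of_is_monoid_morphism.

Lemma compl_projD (x y : completion) k : (x + y) k = x k + y k. Proof. by []. Qed.
Lemma compl_projN (x : completion) k : (- x) k = - x k. Proof. by []. Qed.
Lemma compl_projM (x y : completion) k : (x * y) k = x k * y k. Proof. by []. Qed.
Lemma compl_proj_of s k : compl_of s k = toquo _ s. Proof. by []. Qed.

End Completion.

(* The left T-module T (x)_R N, along c : R -> T: formal sums of pairs modulo
   the congruence generated by the tensor relations.  The additive inverse of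
   a pair (a, x) is (- a, x). *)
Section Tensor.
Variables (R T : comPzRingType) (c : {rmorphism R -> T}) (N : lmodType R).

Inductive tensor_rel : seq (T * N) -> seq (T * N) -> Prop :=
| tensor_refl u : tensor_rel u u
| tensor_sym u v : tensor_rel u v -> tensor_rel v u
| tensor_trans u v w : tensor_rel u v -> tensor_rel v w -> tensor_rel u w
| tensor_cat u u' v v' :
    tensor_rel u u' -> tensor_rel v v' -> tensor_rel (u ++ v) (u' ++ v')
| tensor_catC u v : tensor_rel (u ++ v) (v ++ u)
| tensor_zero x : tensor_rel [:: (0, x)] [::]
| tensor_addl a b x : tensor_rel [:: (a + b, x)] [:: (a, x); (b, x)]
| tensor_addr a x y : tensor_rel [:: (a, x + y)] [:: (a, x); (a, y)]
| tensor_bal a r x : tensor_rel [:: (a * c r, x)] [:: (a, r *: x)].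

Definition tensor_relb (u v : seq (T * N)) : bool := `[< tensor_rel u v >].

Lemma tensor_relb_equiv : equiv_class_of tensor_relb.
Proof.
split=> [u|u v|v u w].
- by apply/asboolP; apply: tensor_refl.
- by apply/asboolP/asboolP; apply: tensor_sym.
- by move=> /asboolP uv /asboolP vw; apply/asboolP; apply: tensor_trans vw.
Qed.

Canonical tensor_equiv := EquivRelPack tensor_relb_equiv.
Canonical tensor_encModRel := defaultEncModRel tensor_relb.

Definition tensor : Type := {eq_quot tensor_relb}.
HB.instance Definition _ := Choice.on tensor.

Definition tensor_class (u : seq (T * N)) : tensor :=
  \pi_({eq_quot tensor_relb}) u.
Definition tensor_repr (t : tensor) : seq (T * N) :=
  repr (t : {eq_quot tensor_relb}).

Lemma tensor_reprK t : tensor_class (tensor_repr t) = t.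
Proof. exact: reprK. Qed.

Lemma tensor_classP u v : tensor_class u = tensor_class v <-> tensor_rel u v.
Proof.
rewrite /tensor_class; split=> [/eqmodP /asboolP //|uv].
by apply/eqmodP/asboolP.
Qed.

Lemma tensor_rel_repr u : tensor_rel (tensor_repr (tensor_class u)) u.
Proof. by apply/tensor_classP; rewrite tensor_reprK. Qed.

Definition pure (a : T) (x : N) : tensor := tensor_class [:: (a, x)].

Definition tensor_add (s t : tensor) : tensor :=
  tensor_class (tensor_repr s ++ tensor_repr t).
Definition tensor_scale (b : T) (t : tensor) : tensor :=
  tensor_class [seq (b * p.1, p.2) | p <- tensor_repr t].

Lemma tensor_addE u v :
  tensor_add (tensor_class u) (tensor_class v) = tensor_class (u ++ v).
Proof. by apply/tensor_classP/tensor_cat; apply: tensor_rel_repr. Qed.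

Lemma tensor_scale_rel b u v : tensor_rel u v ->
  tensor_rel [seq (b * p.1, p.2) | p <- u] [seq (b * p.1, p.2) | p <- v].
Proof.
elim=> {u v} [u|u v _ IH|u v w _ IH1 _ IH2|u u' v v' _ IH1 _ IH2|u v|x|a a' x|a x y|a r x].
- exact: tensor_refl.
- exact: tensor_sym.
- exact: tensor_trans IH2.
- by rewrite !map_cat; apply: tensor_cat.
- by rewrite !map_cat; apply: tensor_catC.
- by rewrite /= mulr0; apply: tensor_zero.
- by rewrite /= mulrDr; apply: tensor_addl.
- exact: tensor_addr.
- by rewrite /= mulrA; apply: tensor_bal.
Qed.

Lemma tensor_scaleE b u :
  tensor_scale b (tensor_class u) = tensor_class [seq (b * p.1, p.2) | p <- u].
Proof. by apply/tensor_classP/tensor_scale_rel/tensor_rel_repr. Qed.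

Lemma tensor_addA : associative tensor_add.
Proof.
move=> s t w; rewrite -[s]tensor_reprK -[t]tensor_reprK -[w]tensor_reprK.
by rewrite !tensor_addE catA.
Qed.

Lemma tensor_addC : commutative tensor_add.
Proof.
move=> s t; rewrite -[s]tensor_reprK -[t]tensor_reprK !tensor_addE.
exact/tensor_classP/tensor_catC.
Qed.

Lemma tensor_add0 : left_id (tensor_class [::]) tensor_add.
Proof. by move=> s; rewrite -[s]tensor_reprK tensor_addE. Qed.

Lemma tensor_rel_scaleD a b u :
  tensor_rel [seq ((a + b) * p.1, p.2) | p <- u]
    ([seq (a * p.1, p.2) | p <- u] ++ [seq (b * p.1, p.2) | p <- u]).
Proof.
elim: u => [|[r x] u IH] /=; first exact: tensor_refl.
set uab := map _ u in IH *; set ua := map _ u in IH *.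
set ub := map _ u in IH *.
apply: (@tensor_trans _ ([:: (a * r, x); (b * r, x)] ++ (ua ++ ub))).
  apply: (@tensor_cat [:: ((a + b) * r, x)]) => //.
  by rewrite mulrDl; apply: tensor_addl.
apply: (@tensor_cat [:: (a * r, x)] [:: (a * r, x)]
  ([:: (b * r, x)] ++ (ua ++ ub)) (ua ++ ([:: (b * r, x)] ++ ub))).
  exact: tensor_refl.
rewrite !catA.
apply: tensor_cat.
  exact: tensor_catC.
exact: tensor_refl.
Qed.

Lemma tensor_rel_scale0 u : tensor_rel [seq (0 * p.1, p.2) | p <- u] [::].
Proof.
elim: u => [|[r x] u IH] /=; first exact: tensor_refl.
rewrite -cat1s -[X in tensor_rel _ X]cats0; apply: tensor_cat => //.
by rewrite mul0r; apply: tensor_zero.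
Qed.

Lemma tensor_addN : left_inverse (tensor_class [::]) (tensor_scale (-1)) tensor_add.
Proof.
move=> s; rewrite -[s]tensor_reprK tensor_scaleE tensor_addE.
apply/tensor_classP; set u := tensor_repr s.
rewrite -[X in _ ++ X]map_id -[X in _ ++ X](_ : [seq (1 * p.1, p.2) | p <- u] = _).
  apply: tensor_trans (tensor_sym (tensor_rel_scaleD _ _ _)) _.
  by rewrite addNr; apply: tensor_rel_scale0.
by apply: eq_map => -[a x] /=; rewrite mul1r.
Qed.

HB.instance Definition _ := GRing.isZmodule.Build tensor
  tensor_addA tensor_addC tensor_add0 tensor_addN.

Lemma tensor_scaleA a b t :
  tensor_scale a (tensor_scale b t) = tensor_scale (a * b) t.
Proof.
rewrite -[t]tensor_reprK !tensor_scaleE -map_comp; congr tensor_class.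
by apply: eq_map => p /=; rewrite mulrA.
Qed.

Lemma tensor_scale1 : left_id 1 tensor_scale.
Proof.
move=> t; rewrite -[t]tensor_reprK tensor_scaleE; congr tensor_class.
by rewrite -[RHS]map_id; apply: eq_map => -[a x] /=; rewrite mul1r.
Qed.

Lemma tensor_scaleDr : right_distributive tensor_scale +%R.
Proof.
move=> a s t; rewrite -[s]tensor_reprK -[t]tensor_reprK.
rewrite [X in tensor_scale a X]tensor_addE !tensor_scaleE.
by rewrite [RHS]tensor_addE map_cat.
Qed.

Lemma tensor_scaleDl t : {morph tensor_scale^~ t : a b / a + b}.
Proof.
move=> a b; rewrite -[t]tensor_reprK !tensor_scaleE [RHS]tensor_addE.
exact/tensor_classP/tensor_rel_scaleD.
Qed.

HB.instance Definition _ := GRing.Zmodule_isLmodule.Build T tensor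
  tensor_scaleA tensor_scale1 tensor_scaleDr tensor_scaleDl.

Lemma tensor_scale_pure b a x : b *: pure a x = pure (b * a) x.
Proof. exact: tensor_scaleE. Qed.

Lemma tensor_sum_pure t : t = \sum_(p <- tensor_repr t) pure p.1 p.2.
Proof.
rewrite -{1}[t]tensor_reprK; elim: (tensor_repr t) => [|[a x] u IH].
  by rewrite big_nil.
by rewrite big_cons -IH; apply: esym; apply: tensor_addE.
Qed.

(* The T-linear map with a (x) x |-> a *: phi x. *)
Section Lift.
Variables (V : lmodType T) (phi : N -> V).
Hypothesis phiD : {morph phi : x y / x + y}.
Hypothesis phiZ : forall r x, phi (r *: x) = c r *: phi x.

Definition tensor_lift (t : tensor) : V :=
  \sum_(p <- tensor_repr t) p.1 *: phi p.2.

Lemma tensor_lift_rel u v : tensor_rel u v ->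
  \sum_(p <- u) p.1 *: phi p.2 = \sum_(p <- v) p.1 *: phi p.2.
Proof.
elim=> {u v} [u|u v _ IH|u v w _ IH1 _ IH2|u u' v v' _ IH1 _ IH2|u v|x|a a' x|a x y|a r x] //.
- by rewrite IH1.
- by rewrite !big_cat IH1 IH2.
- by rewrite !big_cat /= addrC.
- by rewrite big_seq1 big_nil scale0r.
- by rewrite !big_cons !big_nil !addr0 scalerDl.
- by rewrite !big_cons !big_nil !addr0 phiD scalerDr.
- by rewrite !big_seq1 phiZ scalerA.
Qed.

Lemma tensor_lift_class u :
  tensor_lift (tensor_class u) = \sum_(p <- u) p.1 *: phi p.2.
Proof. exact/tensor_lift_rel/tensor_rel_repr. Qed.

Lemma tensor_lift_pure a x : tensor_lift (pure a x) = a *: phi x.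
Proof. by rewrite tensor_lift_class big_seq1. Qed.

Lemma tensor_lift_linear : linear tensor_lift.
Proof.
move=> b s t; rewrite -[s]tensor_reprK -[t]tensor_reprK.
rewrite [b *: _]tensor_scaleE [_ + _]tensor_addE !tensor_lift_class big_cat.
by rewrite big_map scaler_sumr; under eq_bigr do rewrite -scalerA.
Qed.

End Lift.
End Tensor.

(* d is linear for the A-module structure that f puts on S; in particular
   [hom idfun d] means that d belongs to Hom_S(S, S). *)
Definition hom (A S : comPzRingType) (f : {rmorphism A -> S}) (d : S -> S) :
    Prop :=
  forall a x y, d (f a * x + y) = f a * d x + d y.

Definition commutator (S : comPzRingType) (d : S -> S) (s : S) : S -> S :=
  fun x => d (s * x) - s * d x.

Fixpoint is_diffop (A S : comPzRingType) (f : {rmorphism A -> S}) (n : nat)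
    (d : S -> S) : Prop :=
  if n is m.+1 then hom f d /\ forall s, is_diffop f m (commutator d s)
  else hom idfun d.

Section DiffOps.
Variables (A S : comPzRingType) (f : {rmorphism A -> S}).
Implicit Types (d e : S -> S) (m n : nat) (s : S).

Lemma hom_idfun d : hom idfun d -> hom f d.
Proof. by move=> dP a; apply: dP. Qed.

Lemma is_diffop_hom n d : is_diffop f n d -> hom f d.
Proof. by case: n => [/hom_idfun|n []]. Qed.

Lemma homD d : hom f d -> {morph d : x y / x + y}.
Proof. by move=> dP x y; have := dP 1 x y; rewrite rmorph1 !mul1r. Qed.

Lemma hom0 d : hom f d -> d 0 = 0.
Proof. by move=> /homD dD; apply: (addIr (d 0)); rewrite -dD !add0r. Qed.

Lemma homM d : hom f d -> forall a x, d (f a * x) = f a * d x.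
Proof. by move=> dP a x; have := dP a x 0; rewrite (hom0 dP) !addr0. Qed.

Lemma homN d : hom f d -> {morph d : x / - x}.
Proof.
by move=> dP x; apply: (addIr (d x)); rewrite -(homD dP) !addNr (hom0 dP).
Qed.

Lemma hom_comp d e : hom f d -> hom f e -> hom f (d \o e).
Proof. by move=> dP eP a x y /=; rewrite eP dP. Qed.

Lemma is_diffop_zero n : is_diffop f n (fun=> 0).
Proof.
elim: n => [|n IH] /=; first by move=> a x y; rewrite mulr0 addr0.
split=> [a x y|s]; first by rewrite mulr0 addr0.
rewrite (_ : commutator _ s = (fun=> 0)) //; apply/funext => x.
by rewrite /commutator mulr0 subr0.
Qed.

Lemma is_diffop_lin n d e s : is_diffop f n d -> is_diffop f n e ->
  is_diffop f n (fun x => s * d x + e x).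
Proof.
elim: n d e => [|n IH] d e /=.
  by move=> dP eP a x y; rewrite dP eP !mulrDr addrACA !(mulrCA s).
move=> [dP dQ] [eP eQ]; split=> [a x y|t].
  by rewrite dP eP !mulrDr addrACA !(mulrCA s).
rewrite (_ : commutator _ t =
  fun x => s * commutator d t x + commutator e t x); first exact: IH.
apply/funext => x; rewrite /commutator mulrBr mulrDr opprD addrACA.
by rewrite (mulrCA t s).
Qed.

Lemma commutator_hom0 d s : hom idfun d -> commutator d s = fun=> 0.
Proof.
move=> dP; apply/funext => x.
have d0 : d 0 = 0 by apply/hom0/hom_idfun/dP.
have := dP s x 0; rewrite /commutator /= d0 !addr0 => ->.
by rewrite subrr.
Qed.

Lemma is_diffopS n d : is_diffop f n d -> is_diffop f n.+1 d.
Proof.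
elim: n d => [|n IH] d.
  move=> dP; split=> [|s]; first exact: hom_idfun.
  by rewrite (commutator_hom0 _ dP); exact: (@is_diffop_zero 0).
by move=> [dP dQ]; split=> // s; exact: IH (dQ s).
Qed.

Lemma is_diffop_le m n d : (m <= n)%N -> is_diffop f m d -> is_diffop f n d.
Proof. by move=> /subnK<-; elim: (n - m)%N => //= k IH /IH/is_diffopS. Qed.

Lemma is_diffop_pred n d s : is_diffop f n d -> is_diffop f n.-1 (commutator d s).
Proof.
case: n => [dP|n [_ dQ]]; last exact: dQ.
rewrite (commutator_hom0 _ dP); exact: (@is_diffop_zero 0).
Qed.

Lemma is_diffop_id : is_diffop f 0 (id : S -> S).
Proof. by []. Qed.

Lemma is_diffop_comp m n d e :
  is_diffop f m d -> is_diffop f n e -> is_diffop f (m + n) (d \o e).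
Proof.
move: {2}(m + n)%N (leqnn (m + n)) => N.
elim: N m n d e => [|N IH] m n d e.
  rewrite leqn0 addn_eq0 => /andP[/eqP-> /eqP->] /= dP eP a x y /=.
  by rewrite eP dP.
move=> mnN dP eP.
have dD : {morph d : x y / x + y} by apply/homD/is_diffop_hom/dP.
case mn0 : (m + n)%N => [|k].
  have := mn0; move/eqP; rewrite addn_eq0 => /andP[/eqP m0 /eqP n0].
  by move: dP eP; rewrite m0 n0 => dP eP a x y /=; rewrite eP dP.
split=> [|s].
  by apply: hom_comp; [exact: is_diffop_hom dP|exact: is_diffop_hom eP].
rewrite (_ : commutator _ s =
  fun x => 1 * (d \o commutator e s) x + (commutator d s \o e) x); last first.
  apply/funext => x; rewrite /commutator /= mul1r addrA -dD subrK.
  by [].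
apply: is_diffop_lin.
  case: n => [|n] in mnN eP mn0 *.
    rewrite (commutator_hom0 _ eP) (_ : _ \o _ = fun=> 0).
      exact: is_diffop_zero.
    by apply/funext => x /=; rewrite (hom0 (is_diffop_hom dP)).
  move: mn0 mnN; rewrite addnS => -[<-] mnN.
  by apply: IH => //; case: eP => _; apply.
case: m => [|m] in mnN dP mn0 *.
  rewrite (commutator_hom0 _ dP) (_ : _ \o _ = fun=> 0) //.
  exact: is_diffop_zero.
move: mn0 mnN; rewrite addSn => -[<-] mnN.
by apply: IH => //; case: dP => _; apply.
Qed.

Lemma is_diffop_continuous (J : ideal S) n d : is_diffop f n d ->
  forall k x, x \in ideal_pow J (n + k) -> d x \in ideal_pow J k.
Proof.
elim: n d => [|n IH] d dP k x.
  elim: k x => [//|k IHk] x /asboolP[u uP ->].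
  have dD : {morph d : x y / x + y} by apply/homD/hom_idfun/dP.
  have d0 : d 0 = 0 by apply/hom0/hom_idfun/dP.
  rewrite big_seq (big_morph d dD d0); apply: rpred_sum => p pu.
  have /andP[p1 p2] := allP uP p pu.
  rewrite (_ : d _ = p.1 * d p.2); last first.
    by have := dP p.1 p.2 0; rewrite /= d0 !addr0.
  by apply/asboolP; exists [:: (p.1, d p.2)]; rewrite ?big_seq1 //= p1 IHk.
case: (dP) => dH dQ; have dD := homD dH; have d0 := hom0 dH.
elim: k x => [//|k IHk] x; rewrite addnS => /asboolP[u uP ->].
rewrite big_seq (big_morph d dD d0); apply: rpred_sum => p pu.
have /andP[p1 p2] := allP uP p pu.
rewrite -[d _](subrK (p.1 * d p.2)); apply: rpredD.
  apply: (IH _ (dQ p.1)).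
  by rewrite addnS -addSn; apply: p2.
apply/asboolP; exists [:: (p.1, d p.2)]; rewrite ?big_seq1 //= p1 andbT.
exact: IHk.
Qed.

End DiffOps.

(* D^n_A(S) and D_A(S) are submodules of S -> S^o, on which S acts by
   (s *: d) x = s * d x.  The product on D_A(S) is composition, not the
   pointwise product of S -> S. *)

Section DiffOpTypes.
Variables (A S : comPzRingType) (f : {rmorphism A -> S}).

Definition diffop_pred (n : nat) : {pred S -> S^o} :=
  fun d => `[< is_diffop f n d >].
Definition diffops_pred : {pred S -> S^o} :=
  fun d => `[< exists n, is_diffop f n d >].

Record diffop (n : nat) :=
  DiffOp { diffop_fun :> S -> S^o; diffop_funP : diffop_pred n diffop_fun }.
Record diffops :=
  DiffOps { diffops_fun :> S -> S^o; diffops_funP : diffops_pred diffops_fun }.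

Lemma diffopP n (d : diffop n) : is_diffop f n d.
Proof. exact/asboolP/diffop_funP. Qed.

Lemma diffopsP (d : diffops) : exists n, is_diffop f n d.
Proof. exact/asboolP/diffops_funP. Qed.

Lemma diffop_pred_closed n : GRing.subsemimod_closed (diffop_pred n).
Proof.
split; first split.
- exact/asboolP/is_diffop_zero.
- move=> d e /asboolP dP /asboolP eP; apply/asboolP.
  have := is_diffop_lin 1 dP eP; congr is_diffop.
  by apply/funext => x; rewrite mul1r.
- move=> s d /asboolP dP; apply/asboolP.
  have := is_diffop_lin s dP (@is_diffop_zero _ _ f n); congr is_diffop.
  by apply/funext => x; rewrite addr0.
Qed.

Lemma diffops_pred_closed : GRing.subsemimod_closed diffops_pred.
Proof.
split; first split.
- by apply/asboolP; exists 0%N; apply: is_diffop_zero.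
- move=> d e /asboolP[m dP] /asboolP[n eP]; apply/asboolP; exists (maxn m n).
  apply/asboolP/(diffop_pred_closed _).1.2; apply/asboolP.
    exact: is_diffop_le (leq_maxl _ _) dP.
  exact: is_diffop_le (leq_maxr _ _) eP.
- move=> s d /asboolP[n dP]; apply/asboolP; exists n.
  by apply/asboolP/(diffop_pred_closed n).2/asboolP.
Qed.

HB.instance Definition _ n := [isSub for @diffop_fun n].
HB.instance Definition _ n := [Choice of diffop n by <:].
HB.instance Definition _ n := GRing.SubChoice_isSubLmodule.Build
  S (S -> S^o) (diffop_pred n) (diffop n) (diffop_pred_closed n).

HB.instance Definition _ := [isSub for diffops_fun].
HB.instance Definition _ := [Choice of diffops by <:].
HB.instance Definition _ := GRing.SubChoice_isSubLmodule.Build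
  S (S -> S^o) diffops_pred diffops diffops_pred_closed.

Definition diffops_one : diffops.
Proof.
by apply: (@DiffOps id); apply/asboolP; exists 0%N; apply: is_diffop_id.
Defined.

Definition diffops_comp (d e : diffops) : diffops.
Proof.
apply: (@DiffOps (d \o e)); apply/asboolP.
have [m dP] := diffopsP d; have [n eP] := diffopsP e.
by exists (m + n)%N; apply: is_diffop_comp.
Defined.

Lemma diffops_compA : associative diffops_comp.
Proof. by move=> d e g; apply: val_inj. Qed.
Lemma diffops_comp1l : left_id diffops_one diffops_comp.
Proof. by move=> d; apply: val_inj. Qed.
Lemma diffops_comp1r : right_id diffops_one diffops_comp.
Proof. by move=> d; apply: val_inj. Qed.
Lemma diffops_compDl : left_distributive diffops_comp +%R.
Proof. by move=> d e g; apply: val_inj. Qed.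
Lemma diffops_compDr : right_distributive diffops_comp +%R.
Proof.
move=> d e g; apply: val_inj; apply/funext => x /=.
by have [n dP] := diffopsP d; apply: (homD (is_diffop_hom dP)).
Qed.

HB.instance Definition _ := GRing.Zmodule_isPzRing.Build diffops
  diffops_compA diffops_comp1l diffops_comp1r diffops_compDl diffops_compDr.

End DiffOpTypes.

Section Extension.
Variables (A S : comPzRingType) (f : {rmorphism A -> S}) (J : ideal S).
Local Notation Shat := (completion J).

Definition compl_alg : {rmorphism A -> Shat} := compl_of J \o f.

(* F extends d by continuity for the J-adic topologies: for each k there is
   an m such that F x = d s modulo J^k whenever x = s modulo J^m. *)
Definition extends_cont (d : S -> S) (F : Shat -> Shat) : Prop :=
  forall k, exists m, forall (x : Shat) (s : S),
    x m = toquo _ s -> F x k = toquo _ (d s).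

(* The default value 0 is never used for a differential operator (hatP), and
   the extension is unique (extends_cont_unique). *)
Definition hat (d : S -> S) : Shat -> Shat :=
  xget (fun=> 0) [set F | extends_cont d F]%classic.

Lemma extends_cont_unique d F G : extends_cont d F -> extends_cont d G -> F = G.
Proof.
move=> dF dG; apply/funext => x; apply: compl_ext => k.
have [m mF] := dF k; have [m' mG] := dG k.
have [s xs] := compl_approx x (maxn m m').
by rewrite (mF x s) ?(mG x s) ?xs ?leq_maxl ?leq_maxr.
Qed.

Lemma hatE d F : extends_cont d F -> hat d = F.
Proof. by move=> dF; apply: xget_unique => // G /extends_cont_unique; apply. Qed.

Lemma compl_proj_le (x : Shat) k m s :
  (k <= m)%N -> x m = toquo _ s -> x k = toquo _ s.
Proof.
move=> km xs; have [t xt] := compl_approx x m.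
rewrite xt //; apply/toquoP/(ideal_pow_le km)/toquoP.
by rewrite -xt.
Qed.

Lemma hatP n d : is_diffop f n d -> extends_cont d (hat d).
Proof.
move=> dP; suff [F dF] : exists F, extends_cont d F by rewrite (hatE dF).
have dH := is_diffop_hom dP.
have dJ k x y : x - y \in ideal_pow J (n + k) -> d x - d y \in ideal_pow J k.
  by rewrite -(homN dH) -(homD dH); apply: is_diffop_continuous dP _ _.
pose op (x : Shat) k : quo (ideal_pow J k) :=
  toquo _ (d (projT1 (cid (toquo_surj (x (n + k)%N))))).
have opE (x : Shat) k s : x (n + k)%N = toquo _ s -> op x k = toquo _ (d s).
  by rewrite /op; case: cid => t /= -> /toquoP st; apply/toquoP/dJ.
have opP (x : Shat) k : exists s, forall i, (i <= k)%N -> op x i = toquo _ s.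
  have [s xs] := compl_approx x (n + k); exists (d s) => i ik.
  by apply: opE; apply: xs; rewrite leq_add2l.
by exists (fun x => compl_lift0 (opP x)) => k; exists (n + k)%N => x s /opE.
Qed.

Lemma hat_of n d s : is_diffop f n d -> hat d (compl_of J s) = compl_of J (d s).
Proof.
move=> /hatP dF; apply: compl_ext => k; have [m mF] := dF k.
exact: mF.
Qed.

Lemma hat_lin n d e s : is_diffop f n d -> is_diffop f n e ->
  hat (fun x => s * d x + e x) = fun x => compl_of J s * hat d x + hat e x.
Proof.
move=> /hatP dF /hatP eF; apply: hatE => k.
have [m mF] := dF k; have [m' mG] := eF k.
exists (maxn m m') => x t xt.
rewrite compl_projD compl_projM (mF x t) ?(mG x t) ?rmorphD ?rmorphM //.
  by apply: compl_proj_le xt; rewrite leq_maxr.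
by apply: compl_proj_le xt; rewrite leq_maxl.
Qed.

Lemma approx_diffop n (F : Shat -> Shat) :
  (forall k, exists2 d, is_diffop f n d & exists m, forall (x : Shat) s,
    x m = toquo _ s -> F x k = toquo _ (d s)) ->
  is_diffop compl_alg n F.
Proof.
have key (m k : nat) (x y : Shat) : exists s t : S, forall i, (i <= maxn k m)%N ->
    x i = toquo (ideal_pow J i) s /\ y i = toquo (ideal_pow J i) t.
  have [s xs] := compl_approx x (maxn k m).
  have [t yt] := compl_approx y (maxn k m).
  by exists s, t => i ik; rewrite xs ?yt.
elim: n F => [|n IH] F FP.
  move=> a x y; apply: compl_ext => k.
  have [d dP [m dF]] := FP k; have [s [t st]] := key m k x y.
  have [u au] := compl_approx a (maxn k m).
  have [xm ym] := st _ (leq_maxr k m).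
  rewrite /= (dF _ (u * s + t)) ?compl_projD ?compl_projM ?(dF x s) ?(dF y t) //.
    rewrite (au _ (leq_maxl _ _)) -rmorphM -rmorphD.
    by rewrite (dP u s t).
  by rewrite xm ym (au _ (leq_maxr _ _)) -rmorphM -rmorphD.
split=> [a x y|t].
  apply: compl_ext => k.
  have [d [dP _] [m dF]] := FP k; have [s [t st]] := key m k x y.
  have [xm ym] := st _ (leq_maxr k m).
  rewrite /= (dF _ (f a * s + t)) ?compl_projD ?compl_projM ?(dF x s) ?(dF y t) //.
    by rewrite dP rmorphD rmorphM.
  by rewrite xm ym compl_proj_of -rmorphM -rmorphD.
apply: IH => k; have [d dP [m dF]] := FP k.
have [u tu] := compl_approx t (maxn k m).
exists (commutator d u); first exact: dP.2.
exists m => x s xs; rewrite /commutator compl_projD compl_projN compl_projM.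
rewrite (dF _ (u * s)) ?(dF x s) ?(tu _ (leq_maxl _ _)) //.
  by rewrite -rmorphM -rmorphB.
by rewrite compl_projM xs (tu _ (leq_maxr _ _)) -rmorphM.
Qed.

Lemma is_diffop_hat n d : is_diffop f n d -> is_diffop compl_alg n (hat d).
Proof. by move=> dP; apply: approx_diffop => k; exists d => //; apply: hatP dP k. Qed.

Definition hat_diffop n (d : diffop f n) : diffop compl_alg n :=
  @DiffOp _ _ compl_alg n (hat d)
    (introT (asboolP _) (is_diffop_hat (diffopP d))).

Lemma hat_diffops_proof (d : diffops f) : diffops_pred compl_alg (hat d).
Proof.
by apply/asboolP; have [n /is_diffop_hat dP] := diffopsP d; exists n.
Qed.

Definition hat_diffops (d : diffops f) : diffops compl_alg :=
  DiffOps (hat_diffops_proof d).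

End Extension.

Section NaturalMap.
Variables (A S : comPzRingType) (f : {rmorphism A -> S}) (J : ideal S).
Local Notation Shat := (completion J).

Lemma hat_diffopD n : {morph @hat_diffop A S f J n : d e / d + e}.
Proof.
move=> d e; apply: val_inj => /=.
have := hat_lin J 1 (diffopP d) (diffopP e); rewrite rmorph1.
rewrite (_ : (fun x => 1 * d x + e x) = (d + e : diffop f n)); last first.
  by apply/funext => x; rewrite mul1r.
by move=> ->; apply/funext => x; rewrite mul1r.
Qed.

Lemma hat_diffopZ n s (d : diffop f n) :
  hat_diffop J (s *: d) = compl_of J s *: hat_diffop J d.
Proof.
apply: val_inj => /=.
have := hat_lin J s (diffopP d) (@is_diffop_zero _ _ f n).
rewrite (_ : (fun x => s * d x + 0) = (s *: d : diffop f n)); last first.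
  by apply/funext => x; rewrite addr0.
have -> : hat (J := J) (fun=> 0) = fun=> 0.
  by apply: hatE => k; exists 0%N.
by move=> ->; apply/funext => x; rewrite addr0.
Qed.

Lemma hat_diffopsD : {morph @hat_diffops A S f J : d e / d + e}.
Proof.
move=> d e; have [m dP] := diffopsP d; have [n eP] := diffopsP e.
have d'P := is_diffop_le (leq_maxl m n) dP.
have e'P := is_diffop_le (leq_maxr m n) eP.
have := hat_diffopD (DiffOp (introT (asboolP _) d'P))
                    (DiffOp (introT (asboolP _) e'P)).
by move=> /(congr1 val) H; apply: val_inj; exact: H.
Qed.

Lemma hat_diffopsZ s (d : diffops f) :
  hat_diffops J (s *: d) = compl_of J s *: hat_diffops J d.
Proof.
have [n dP] := diffopsP d.
have := hat_diffopZ s (DiffOp (introT (asboolP _) dP)).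
by move=> /(congr1 val) H; apply: val_inj; exact: H.
Qed.

Definition nat_map_fun n :
    tensor (compl_of J) (diffop f n) -> diffop (compl_alg f J) n :=
  tensor_lift (@hat_diffop A S f J n).
HB.instance Definition _ n := GRing.isLinear.Build Shat
  (tensor (compl_of J) (diffop f n)) (diffop (compl_alg f J) n) _
  (@nat_map_fun n) (tensor_lift_linear (@hat_diffopD n) (@hat_diffopZ n)).

Definition nat_map_all_fun :
    tensor (compl_of J) (diffops f) -> diffops (compl_alg f J) :=
  tensor_lift (@hat_diffops A S f J).
HB.instance Definition _ := GRing.isLinear.Build Shat
  (tensor (compl_of J) (diffops f)) (diffops (compl_alg f J)) _
  nat_map_all_fun (tensor_lift_linear hat_diffopsD hat_diffopsZ).

Definition nat_map n :
    {linear tensor (compl_of J) (diffop f n) -> diffop (compl_alg f J) n} :=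
  @nat_map_fun n.

Definition nat_map_all :
    {linear tensor (compl_of J) (diffops f) -> diffops (compl_alg f J)} :=
  nat_map_all_fun.

Lemma nat_map_pure n a (d : diffop f n) :
  nat_map n (pure _ a d) = a *: hat_diffop J d.
Proof. exact: (tensor_lift_pure (@hat_diffopD n) (@hat_diffopZ n)). Qed.

Lemma nat_map_all_pure a (d : diffops f) :
  nat_map_all (pure _ a d) = a *: hat_diffops J d.
Proof. exact: (tensor_lift_pure hat_diffopsD hat_diffopsZ). Qed.

(* [mul] makes the tensor product of the completion with D_A(S) into a ring,
   compatibly with its left module structure and with composition in D_A(S).
   This leaves only the products (1 (x) d)(a (x) 1) free.  They have to obey
   the defining rule of differential operators: the commutator of d with a
   vanishes if d has order 0, and has order at most n if d has order n + 1. *)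

Local Notation T := (tensor (compl_of J) (diffops f)).

Definition pure_all (a : Shat) (d : diffops f) : T := pure (compl_of J) a d.

Definition has_order_le (n : nat) (t : T) : Prop :=
  exists2 u : seq (Shat * diffops f),
    forall p, p \in u -> is_diffop f n p.2
  & t = \sum_(p <- u) pure_all p.1 p.2.

Record tensor_ring_mul (mul : T -> T -> T) : Prop := {
  trm_assoc : associative mul;
  trm_id_l : left_id (pure_all 1 1) mul;
  trm_id_r : right_id (pure_all 1 1) mul;
  trm_dist_l : left_distributive mul +%R;
  trm_dist_r : right_distributive mul +%R;
  trm_scale : forall (a : Shat) (t : T), mul (pure_all a 1) t = a *: t;
  trm_comp : forall d e : diffops f,
    mul (pure_all 1 d) (pure_all 1 e) = pure_all 1 (d * e);
  trm_comm0 : forall (d : diffops f) (a : Shat), is_diffop f 0 d ->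
    mul (pure_all 1 d) (pure_all a 1) = pure_all a d;
  trm_commS : forall n (d : diffops f) (a : Shat), is_diffop f n.+1 d ->
    has_order_le n (mul (pure_all 1 d) (pure_all a 1) - pure_all a d) }.

End NaturalMap.

Arguments nat_map {A S} f J n.
Arguments nat_map_all {A S} f J.
Arguments pure_all {A S} f J a d.

(* Main.v *)
Require Import Defs.
From mathcomp Require Import all_boot all_algebra.
From mathcomp Require Import boolp.

Set Implicit Arguments.
Unset Strict Implicit.
Unset Printing Implicit Defensive.

Import GRing.Theory.
Local Open Scope ring_scope.

(* Write T for the completion of S.  Since S is essentially of finite type,
   there are finitely many e_i in S such that every d in D^n_A(S, T) satisfies
   d s = sum_i w_i(s) d(e_i) with coefficients w_i(s) in S that do not depend
   on d.  So D^n_A(S, T) embeds into T^N as the solution set of the linear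
   relations over S shared by all vectors (d(e_i))_i, and finitely many of them
   suffice because S is noetherian.  T is flat over S: by Artin-Rees, a solution
   in T^N of a finite linear system over S is a T-combination of solutions in
   S^N, and these are the value vectors of elements of D^n_A(S).  Thus
   D^n_A(S, T) is generated over T by D^n_A(S), and the relations between these
   generators come, by flatness again, from relations over S.  Finally an
   operator on T that vanishes on S is zero: its commutators with elements of S
   vanish on S too, so by induction on the order it is S-linear; hence it
   preserves the kernels J^k T of the projections T -> S/J^k, and S is dense. *)

(** * Noetherian modules: ascending chains and maximal submodules *)

Lemma dependent_choice_nat (T : Type) (P : nat -> T -> Prop)
    (R : nat -> T -> T -> Prop) x0 : P 0%N x0 ->
  (forall n x, P n x -> exists2 y, P n.+1 y & R n x y) ->
  exists u : nat -> T, forall n, P n (u n) /\ R n (u n) (u n.+1).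
Proof.
move=> P0 PS.
have /choice[g gP] (p : nat * T) :
    exists y, P p.1 p.2 -> P p.1.+1 y /\ R p.1 p.2 y.
  have [/PS[y Py Ry]|nP] := pselect (P p.1 p.2); first by exists y.
  by exists x0.
pose fix u n := if n is k.+1 then g (k, u k) else x0.
have uP n : P n (u n) by elim: n => //= n IH; case: (gP (n, u n)).
by exists u => n; split; last by case: (gP (n, u n)).
Qed.

Section Submodules.
Variables (R : comPzRingType) (M : lmodType R).
Implicit Types (P : R -> Prop) (Q V : M -> Prop).

(** The scalars are cut down by a predicate [P], so that modules over a subring of [R] need no ring
    type of their own. *)
Definition submod P Q : Prop :=
  [/\ Q 0, forall x y, Q x -> Q y -> Q (x + y)
    & forall a x, P a -> Q x -> Q (a *: x)].

(** Generation is stated as an induction principle over submodules, which avoids explicit linear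
    combinations. *)
Definition fin_gen P Q : Prop :=
  exists2 s : seq M, (forall x, x \in s -> Q x)
  & forall Q', submod P Q' -> (forall x, x \in s -> Q' x) ->
      forall x, Q x -> Q' x.

Definition noeth P V : Prop :=
  forall Q, submod P Q -> (forall x, Q x -> V x) -> fin_gen P Q.

Lemma submod_sum P Q I (r : seq I) (p : pred I) (F : I -> M) :
  submod P Q -> (forall i, p i -> Q (F i)) -> Q (\sum_(i <- r | p i) F i).
Proof. by case=> Q0 QD _ QF; apply: big_ind. Qed.

Lemma submodB P Q x y : submod P Q -> P (-1) -> Q x -> Q y -> Q (x - y).
Proof.
by case=> _ QD QZ P1 Qx Qy; apply: QD => //; rewrite -scaleN1r; apply: QZ.
Qed.

(** The union of the chain is a submodule, and its finitely many generators all lie in one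
    member. *)
Lemma noeth_chain P V (Q : nat -> M -> Prop) : noeth P V ->
  (forall i, submod P (Q i)) -> (forall i x, Q i x -> V x) ->
  (forall i x, Q i x -> Q i.+1 x) ->
  exists c, forall i x, Q i x -> Q c x.
Proof.
move=> nV Qsub QV QS.
have Qle i j x : (i <= j)%N -> Q i x -> Q j x.
  by move=> /subnK <-; elim: (j - i)%N => //= k IH /IH/QS.
have [||s sQ sgen] := nV (fun x => exists i, Q i x).
- split; first by exists 0%N; case: (Qsub 0%N).
    move=> x y [i xi] [j yj]; exists (maxn i j).
    by case: (Qsub (maxn i j)) => _ QD _; apply: QD;
      [apply: Qle xi; rewrite leq_maxl|apply: Qle yj; rewrite leq_maxr].
  by move=> a x Pa [i xi]; exists i; case: (Qsub i) => _ _; apply.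
- by move=> x [i /QV].
suff [c cP] : exists c, forall x, x \in s -> Q c x.
  by exists c => i x xi; apply: (sgen (Q c)) => //; exists i.
elim: s sQ {sgen} => [|x s IH] sQ; first by exists 0%N.
have [|c cP] := IH; first by move=> y ys; apply: sQ; rewrite inE ys orbT.
have [i xi] := sQ x (mem_head _ _).
exists (maxn i c) => y; rewrite inE => /predU1P[->|/cP yc].
  by apply: Qle xi; rewrite leq_maxl.
by apply: Qle yc; rewrite leq_maxr.
Qed.

(** Without a maximal member, dependent choice would build a strictly increasing chain in [F]. *)
Lemma noeth_max P V (F : (M -> Prop) -> Prop) Q0 : noeth P V ->
  (forall Q, F Q -> submod P Q /\ forall x, Q x -> V x) -> F Q0 ->
  exists2 Q, F Q & forall Q', F Q' -> (forall x, Q x -> Q' x) ->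
    forall x, Q' x -> Q x.
Proof.
move=> nV FV F0; apply: contrapT => noQ.
have [|u uP] := @dependent_choice_nat _ (fun=> F)
  (fun _ Q Q' => (forall x, Q x -> Q' x) /\ ~ (forall x, Q' x -> Q x)) Q0 F0.
  move=> _ Q FQ; apply: contrapT => noQ'; apply: noQ; exists Q => // Q' FQ' QQ'.
  by apply: contrapT => nQ; apply: noQ'; exists Q'.
have [i|i x||c cP] := noeth_chain (Q := u) nV.
- by case: (uP i) => /FV[].
- by case: (uP i) => /FV[] _ /(_ x).
- by move=> i; case: (uP i) => _ [].
by case: (uP c) => _ [_]; apply; apply: cP.
Qed.

End Submodules.

(** * Hilbert's basis theorem for a subring with one more generator *)

Definition subring_pred (R : comPzRingType) (P : R -> Prop) : Prop :=
  [/\ P 1, forall x y, P x -> P y -> P (x - y)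
    & forall x y, P x -> P y -> P (x * y)].

Section SubringPred.
Variables (R : comPzRingType) (P : R -> Prop).
Hypothesis subP : subring_pred P.

Lemma subring_pred1 : P 1. Proof. by case: subP. Qed.
Lemma subring_predB a b : P a -> P b -> P (a - b).
Proof. by case: subP => _ + _; apply. Qed.
Lemma subring_predM a b : P a -> P b -> P (a * b).
Proof. by case: subP => _ _; apply. Qed.
Lemma subring_pred0 : P 0.
Proof. by rewrite -(subrr 1); apply: subring_predB; apply: subring_pred1. Qed.
Lemma subring_predN a : P a -> P (- a).
Proof. by rewrite -sub0r; apply/subring_predB/subring_pred0. Qed.
Lemma subring_predD a b : P a -> P b -> P (a + b).
Proof. by move=> Pa Pb; rewrite -[b]opprK; apply/subring_predB/subring_predN. Qed.

End SubringPred.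

Section Adjoin.
Variables (B : comPzRingType) (P : B -> Prop) (x : B).
Hypothesis subP : subring_pred P.

(** These are the values at [x] of the polynomials of degree less than [n] over [P], with the top
    coefficient split off first. *)
Fixpoint poly_value (n : nat) (y : B) : Prop :=
  if n is m.+1 then exists2 a, P a & poly_value m (y - a * x ^+ m) else y = 0.

Definition adjoin (y : B) : Prop := exists n, poly_value n y.

Lemma poly_valueB n y z :
  poly_value n y -> poly_value n z -> poly_value n (y - z).
Proof.
elim: n y z => [|n IH] y z /=; first by move=> -> ->; rewrite subr0.
move=> [a Pa ya] [b Pb zb]; exists (a - b); first exact: subring_predB.
by rewrite mulrBl opprD addrACA -opprD; apply: IH.
Qed.

Lemma poly_value0 n : poly_value n 0.
Proof.
elim: n => //= n IH; exists 0; first exact: (subring_pred0 subP).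
by rewrite mul0r subr0.
Qed.

Lemma poly_valueD n y z :
  poly_value n y -> poly_value n z -> poly_value n (y + z).
Proof.
move=> yn zn; rewrite -[z]opprK -[- z]sub0r; apply: poly_valueB => //.
by apply: poly_valueB => //; apply: poly_value0.
Qed.

Lemma poly_valueZ n a y : P a -> poly_value n y -> poly_value n (a * y).
Proof.
move=> Pa; elim: n y => [|n IH] y /=; first by move=> ->; rewrite mulr0.
move=> [b Pb /IH yb]; exists (a * b); first exact: (subring_predM subP).
by rewrite -mulrA -mulrBr.
Qed.

Lemma poly_valueX n k y : poly_value n y -> poly_value (n + k) (x ^+ k * y).
Proof.
elim: n y => [|n IH] y /=; first by move=> ->; rewrite mulr0; apply: poly_value0.
by move=> [a Pa /IH ya]; exists a; rewrite // addnC exprD mulrCA -mulrBr addnC.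
Qed.

Lemma poly_value_le m n y : (m <= n)%N -> poly_value m y -> poly_value n y.
Proof.
move=> /subnK <-; elim: (n - m)%N => //= k IH /IH ym.
by exists 0; [exact: (subring_pred0 subP)|rewrite mul0r subr0].
Qed.

Lemma adjoin_sub y : P y -> adjoin y.
Proof. by move=> Py; exists 1%N; exists y; rewrite //= expr0 mulr1 subrr. Qed.

Lemma adjoinB y z : adjoin y -> adjoin z -> adjoin (y - z).
Proof.
move=> [m ym] [n zn]; exists (maxn m n); apply: poly_valueB.
  by apply: poly_value_le ym; apply: leq_maxl.
by apply: poly_value_le zn; apply: leq_maxr.
Qed.

Lemma adjoin_gen : adjoin x.
Proof.
exists 2%N; exists 1; first exact: subring_pred1.
exists 0; first exact: (subring_pred0 subP).
by rewrite /= expr1 mul1r subrr mul0r subr0.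
Qed.

Lemma subring_adjoin : subring_pred adjoin.
Proof.
split; [exact/adjoin_sub/(subring_pred1 subP)|exact: adjoinB|move=> y z [n yn] [k zk]].
elim: n y yn => [y ->|n IH y [a Pa /IH yz]].
  by rewrite mul0r; exists 0%N.
rewrite -[y](subrK (a * x ^+ n)) mulrDl -[X in _ + X]opprK.
apply: adjoinB => //; rewrite -[X in adjoin X]sub0r.
apply: adjoinB; first exact/adjoin_sub/(subring_pred0 subP).
by exists (k + n)%N; rewrite -mulrA; apply/poly_valueZ/poly_valueX.
Qed.

Lemma adjoinX k : adjoin (x ^+ k).
Proof.
elim: k => [|k IH]; first exact/adjoin_sub/(subring_pred1 subP).
by rewrite exprS; apply: (subring_predM subring_adjoin) => //; exact: adjoin_gen.
Qed.

Lemma adjoin_submodB (Q : B^o -> Prop) : submod adjoin Q ->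
  forall y z, Q y -> Q z -> Q (y - z).
Proof.
move=> Qs y z; apply: (submodB Qs); apply: (subring_predN subring_adjoin).
exact: subring_pred1 subring_adjoin.
Qed.

(* [L n] is the ideal of the leading coefficients at degree [n] of the
   polynomial values in [I]. *)
Lemma noeth_adjoin : noeth (M := B^o) P P -> noeth (M := B^o) adjoin adjoin.
Proof.
move=> nP I Isub IP; case: (Isub) => I0 ID IZ.
pose L n (b : B^o) := P b /\ exists2 y : B^o, I y & poly_value n (y - b * x ^+ n).
have Lsub n : submod P (L n).
  split.
  - split; first exact: (subring_pred0 subP).
    by exists 0 => //; rewrite mul0r subr0; apply: poly_value0.
  - move=> a b [Pa [y Iy ya]] [Pb [z Iz zb]]; split; first exact: (subring_predD subP).
    exists (y + z); first exact: ID.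
    by rewrite mulrDl opprD addrACA; apply: poly_valueD.
  - move=> a b Pa [Pb [y Iy yb]]; split; first exact: (subring_predM subP).
    exists (a * y); first by apply: IZ => //; apply: adjoin_sub.
    by rewrite -[a *: b]/(a * b) -mulrA -mulrBr; apply: poly_valueZ.
have LX n k b : L n b -> L (n + k)%N b.
  move=> [Pb [y Iy yb]]; split=> //; exists (x ^+ k * y).
    by apply: IZ => //; apply: adjoinX.
  have := poly_valueX k yb; congr poly_value.
  by rewrite mulrBr mulrCA -exprD addnC.
have [||c cP] := noeth_chain nP Lsub; first by move=> i b [].
  by move=> i b /(LX i 1%N); rewrite addn1.
(* The list consists of lifts to [I] of generators of [L n]. A submodule [Q] containing them meets
   [I] in elements with every leading coefficient from [L n]. *)
have wit n : exists2 s : seq B^o, (forall y, y \in s -> I y) &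
    forall Q, submod adjoin Q -> (forall y, y \in s -> Q y) ->
    forall b, L n b -> exists y : B^o, [/\ I y, Q y & poly_value n (y - b * x ^+ n)].
  have [|s sL sgen] := nP _ (Lsub n); first by move=> ? [].
  have /choice[w wP] (b : B^o) : exists y : B^o,
      b \in s -> I y /\ poly_value n (y - b * x ^+ n).
    have [/sL[_ [y Iy yb]]|] := boolP (b \in s); first by exists y.
    by exists 0.
  exists [seq w b | b <- s] => [_ /mapP[b /wP[Ib _] ->] //|Q Qs Qw].
  case: (Qs) => Q0 QD QZ.
  apply: sgen.
    split.
    - by exists 0; split=> //; rewrite mul0r subr0; apply: poly_value0.
    - move=> a b [y [Iy Qy ya]] [z [Iz Qz zb]]; exists (y + z); split.
      + exact: ID.
      + exact: QD.
      + by rewrite mulrDl opprD addrACA; apply: poly_valueD.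
    - move=> a b Pa [y [Iy Qy yb]]; exists (a * y).
      have aP : adjoin a by apply: adjoin_sub.
      split; [exact: IZ|exact: QZ|].
      by rewrite -[a *: b]/(a * b) -mulrA -mulrBr; apply: poly_valueZ.
  move=> b bs; have [Iw wb] := wP b bs; exists (w b); split=> //.
  by apply: Qw; apply: map_f.
have /choice[s sP] n : exists s : seq B^o, (forall y, y \in s -> I y) /\
    forall Q, submod adjoin Q -> (forall y, y \in s -> Q y) ->
    forall b, L n b -> exists y : B^o, [/\ I y, Q y & poly_value n (y - b * x ^+ n)].
  by have [s] := wit n; exists s.
exists (flatten [seq s n | n <- iota 0 c.+1]).
  by move=> y /flatten_mapP[n _]; apply: (sP n).1.
move=> Q Qs Qgen; case: (Qs) => Q0 QD QZ.
have QL n b : (n <= c)%N -> L n b ->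
    exists y : B^o, [/\ I y, Q y & poly_value n (y - b * x ^+ n)].
  move=> nc; apply: (sP n).2 => // y ys; apply: Qgen; apply/flatten_mapP.
  by exists n => //; rewrite mem_iota.
(* Induction on the degree: subtracting an element of both [I] and [Q] with the same leading
   coefficient lowers it. *)
have key n : forall y : B^o, I y -> poly_value n y -> Q y.
  elim: n => [|n IH] y Iy /=; first by move=> ->.
  move=> [a Pa ya].
  have La : L n a by split=> //; exists y.
  have [z [Iz Qz za]] : exists z : B^o, [/\ I z, Q z & poly_value n (z - a * x ^+ n)].
    have [nc|cn] := leqP n c; first exact: QL.
    (* Beyond degree [c] the coefficient already lies in [L c]; the element found there is shifted
       by a power of [x]. *)
    have [z [Iz Qz za]] := QL c a (leqnn c) (cP n a La).
    have xP := adjoinX (n - c).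
    exists (x ^+ (n - c) * z); split; [exact: IZ|exact: QZ|].
    have := poly_valueX (n - c) za; rewrite subnKC 1?ltnW //; congr poly_value.
    by rewrite mulrBr mulrCA -exprD subnK // ltnW.
  rewrite -[y](subrK z); apply: QD => //; apply: IH.
    exact: adjoin_submodB.
  by have := poly_valueB ya za; rewrite opprB addrA subrK.
by move=> y Iy; have [n yn] := IP y Iy; apply: key yn.
Qed.

End Adjoin.

(** * Noetherianity of algebras essentially of finite type *)

Lemma noetherian_noeth (A : comPzRingType) : noetherian A ->
  noeth (M := A^o) (fun=> True) (fun=> True).
Proof.
move=> hA Q Qs _; case: (Qs) => Q0 QD QZ.
have I0 : 0 \in (fun a : A => `[< Q a >] : bool) by apply/asboolP.
have ID : {in (fun a : A => `[< Q a >]) &, forall x y,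
    x + y \in (fun a : A => `[< Q a >])}.
  by move=> y z /asboolP Qy /asboolP Qz; apply/asboolP/QD.
have IM a : {in (fun a : A => `[< Q a >]), forall x,
    a * x \in (fun a : A => `[< Q a >])}.
  by move=> y /asboolP Qy; apply/asboolP/QZ.
have [g gP] := hA (Ideal I0 ID IM).
have QE y : Q y <-> y \in Ideal I0 ID IM.
  by split=> [Qy|/asboolP //]; apply/asboolP.
exists g => [y /(nthP 0)[i ig <-]|Q' Q's gQ' y /QE/gP[a ->]].
  apply/QE/gP; exists (fun j => (j == i)%:R).
  rewrite (bigD1 (Ordinal ig)) //= eqxx mul1r big1 ?addr0 // => j /negPf ji.
  by rewrite -[_ == i]/(j == Ordinal ig) ji mul0r.
apply: (submod_sum _ Q's) => i _; case: Q's => _ _; apply=> //.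
by apply: gQ'; apply: mem_nth.
Qed.

(** Starting from the image of [A], the generators are adjoined one at a time by [noeth_adjoin]; the
    subring reached at the end is all of [B]. *)
Lemma noeth_finite_type (A B : comPzRingType) (g : {rmorphism A -> B}) :
  noetherian A -> finite_type g ->
  noeth (M := B^o) (fun=> True) (fun=> True).
Proof.
move=> /noetherian_noeth nA [gens gensP].
pose im b := exists a, b = g a.
have subim : subring_pred im.
  split; first by exists 1; rewrite rmorph1.
    by move=> _ _ [a ->] [b ->]; exists (a - b); rewrite rmorphB.
  by move=> _ _ [a ->] [b ->]; exists (a * b); rewrite rmorphM.
have nim : noeth (M := B^o) im im.
  move=> I [I0 ID IZ] Iim.
  have [|//|s sI sgen] := nA (fun a => I (g a)).
    split=> [|a b Ia Ib|a b _ Ib]; first by rewrite rmorph0.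
      by rewrite rmorphD; apply: ID.
    by rewrite rmorphM; apply: IZ => //; exists a.
  exists [seq g a | a <- s] => [_ /mapP[a /sI Ia ->] //|Q [Q0 QD QZ] Qs b Ib].
  have [a ba] := Iim b Ib; rewrite {}ba in Ib *.
  apply: (sgen (fun a => Q (g a))) Ib => [|a' a's]; last exact/Qs/map_f.
  split=> [|a1 a2 Q1 Q2|a1 a2 _ Q2]; first by rewrite rmorph0.
    by rewrite rmorphD; apply: QD.
  by rewrite rmorphM; apply: QZ => //; exists a1.
suff [P [subP nP imP gP]] : exists P : B -> Prop, [/\ subring_pred P,
    noeth (M := B^o) P P, forall a, P (g a) & forall b, b \in gens -> P b].
  have Pall b : P b.
    by apply: gensP => //; [move=> *; apply: subring_predD|move=> *; apply: subring_predM].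
  move=> Q [Q0 QD QZ] _.
  have [||s sQ sgen] := nP Q; [by split=> // a x _; apply: QZ|by []|].
  exists s => // Q' [Q'0 Q'D Q'Z] sQ'; apply: sgen => //; split=> // a x _.
  exact: Q'Z.
elim: {gensP} gens => [|x gens [P [subP nP imP gP]]].
  by exists im; split=> // a; exists a.
exists (adjoin P x); split.
- exact: subring_adjoin.
- exact: noeth_adjoin.
- by move=> a; apply: adjoin_sub.
- move=> b; rewrite inE => /predU1P[->|/gP Pb]; first exact: adjoin_gen.
  exact: adjoin_sub.
Qed.

(** Every element of [S] is a unit times an image from [B], so an ideal is generated by the images
    of generators of its preimage. *)
Lemma noeth_localization (B S : comPzRingType) (M : B -> Prop)
    (h : {rmorphism B -> S}) : is_localization M h ->
  noeth (M := B^o) (fun=> True) (fun=> True) ->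
  noeth (M := S^o) (fun=> True) (fun=> True).
Proof.
move=> [hu hs _] nB I [I0 ID IZ] _.
have pull (Q : S^o -> Prop) : submod (fun=> True) Q ->
    submod (M := B^o) (fun=> True) (fun b => Q (h b)).
  move=> [Q0 QD QZ]; split=> [|a b Qa Qb|a b _ Qb]; first by rewrite rmorph0.
    by rewrite rmorphD; apply: QD.
  by rewrite rmorphM; apply: QZ.
have [||s sI sgen] := nB (fun b => I (h b)); [exact: pull|by []|].
exists [seq h b | b <- s] => [_ /mapP[b /sI Ib ->] //|Q Qs Qg y Iy].
have [b [m [Mm ym]]] := hs y; have [u um] := hu m Mm.
have Qb : Q (h b).
  apply: (sgen (fun b => Q (h b))); first exact: pull.
    by move=> a sa; apply/Qg/map_f.
  by rewrite -ym mulrC; apply: IZ.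
have -> : y = u * h b by rewrite -ym mulrCA um mulr1.
by case: Qs => _ _; apply.
Qed.

Lemma noeth_ess_finite_type (A S : comPzRingType) (f : {rmorphism A -> S}) :
  noetherian A -> ess_finite_type f ->
  noeth (M := S^o) (fun=> True) (fun=> True).
Proof.
move=> hA [B [g [h [M [gft _ hloc _]]]]].
exact: noeth_localization hloc (noeth_finite_type hA gft).
Qed.

(** * Finite free modules over a noetherian ring *)

Section Rows.
Variable S : comPzRingType.
Hypothesis nS : noeth (M := S^o) (fun=> True) (fun=> True).

(** Induction on the number of coordinates that may be nonzero: the last of them maps [Q] onto an
    ideal, whose generators are lifted, and the part of [Q] where it vanishes is covered by
    induction. *)
Lemma noeth_row N : noeth (M := 'rV[S]_N) (fun=> True) (fun=> True).
Proof.
suff nk k : noeth (M := 'rV[S]_N) (fun=> True)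
    (fun v => forall i : 'I_N, (k <= i)%N -> v 0 i = 0).
  move=> Q Qs _; apply: (nk N) => // v _ i; by rewrite leqNgt ltn_ord.
elim: k => [|k IH] Q Qs Qk.
  exists [::] => // Q' [Q'0 _ _] _ x /Qk x0.
  by rewrite (_ : x = 0) //; apply/rowP => i; rewrite mxE x0.
have [Nk|kN] := leqP N k.
  apply: IH => // v Qv i ki.
  by have := ltn_ord i; rewrite ltnNge (leq_trans Nk ki).
pose o := Ordinal kN; case: (Qs) => Q0 QD QZ.
have [||s sQ sgen] := IH (fun v => Q v /\ v 0 o = 0).
- split=> [|x y [Qx x0] [Qy y0]|a x _ [Qx x0]]; first by rewrite mxE.
    by split; [exact: QD|rewrite mxE x0 y0 addr0].
  by split; [exact: QZ|rewrite mxE x0 mulr0].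
- move=> v [Qv vo] i; rewrite leq_eqVlt => /predU1P[ki|]; last exact: Qk.
  by rewrite (_ : i = o) //; apply: val_inj.
have [||t tQ tgen] := nS (Q := fun b => exists2 v, Q v & v 0 o = b).
- split=> [|_ _ [x Qx <-] [y Qy <-]|a _ _ [x Qx <-]]; first by exists 0; rewrite ?mxE.
    by exists (x + y); [exact: QD|rewrite mxE].
  by exists (a *: x); [exact: QZ|rewrite mxE].
- by [].
have /choice[w wP] (b : S^o) : exists v, b \in t -> Q v /\ v 0 o = b.
  by have [/tQ[v Qv vb]|_] := boolP (b \in t); [exists v|exists 0].
exists ([seq w b | b <- t] ++ s).
  by move=> x; rewrite mem_cat => /orP[/mapP[b /wP[Qw _] ->]|/sQ[]].
move=> Q' Q's gQ' x Qx; case: (Q's) => Q'0 Q'D Q'Z.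
have [y [Qy Q'y yx]] : exists y : 'rV[S]_N, [/\ Q y, Q' y & y 0 o = x 0 o].
  apply: (tgen (fun b => exists y : 'rV[S]_N, [/\ Q y, Q' y & y 0 o = b])).
  - split=> [|_ _ [y [Qy Q'y <-]] [z [Qz Q'z <-]]|a _ _ [y [Qy Q'y <-]]].
    + by exists 0; rewrite mxE.
    + by exists (y + z); rewrite mxE; split; [exact: QD|exact: Q'D|].
    + by exists (a *: y); rewrite mxE; split; [exact: QZ|exact: Q'Z|].
  - move=> b bt; have [Qw wb] := wP b bt; exists (w b); split=> //.
    by apply: gQ'; rewrite mem_cat map_f.
  - by exists x.
rewrite -[x](subrK y); apply: Q'D => //; apply: (sgen Q') => //.
  by move=> z zs; apply: gQ'; rewrite mem_cat zs orbT.
by split; [exact: (submodB Qs)|rewrite !mxE yx subrr].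
Qed.

End Rows.

(** * A weak form of the Artin-Rees lemma *)

Section ArtinRees.
Variables (S : comPzRingType) (J : ideal S).
Hypothesis nS : noeth (M := S^o) (fun=> True) (fun=> True).

Lemma ideal_powX k g : g \in J -> g ^+ k \in ideal_pow J k.
Proof.
move=> gJ; elim: k => // k IH; apply/asboolP.
by exists [:: (g, g ^+ k)]; rewrite ?big_seq1 ?exprS //= gJ IH.
Qed.

(* If no power of [J] lay in [I], then with [I'] the stable value of the
   increasing chain [(I : J^i)], multiplying [1] by suitable powers of the
   generators of [J] would give an element of [(I' : J)] outside [I']. *)
Lemma ideal_pow_sub_nil (I : S^o -> Prop) : submod (fun=> True) I ->
  (forall g, g \in J -> exists k, I (g ^+ k)) ->
  exists m, forall a, a \in ideal_pow J m -> I a.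
Proof.
move=> Is Inil; case: (Is) => I0 ID IZ.
pose C i (a : S^o) := forall b, b \in ideal_pow J i -> I (b * a).
have Csub i : submod (fun=> True) (C i).
  split=> [b _|a a' Ca Ca' b bJ|r a _ Ca b bJ]; first by rewrite mulr0.
    by rewrite mulrDr; apply: ID; [exact: Ca|exact: Ca'].
  by rewrite -[r *: a]/(r * a) mulrCA; apply: IZ => //; apply: Ca.
have [|i a Ca b /ideal_powS /Ca //|c cP] := noeth_chain nS Csub; first by [].
have [C0 CD CZ] := Csub c.
suff C1 : C c 1 by exists c => a /C1; rewrite mulr1.
apply: contrapT => nC1.
have [|//|s sJ sgen] := nS (Q := fun a : S^o => a \in J).
  by split=> [|x y xJ yJ|a x _ xJ]; [exact: ideal0|exact: idealD|exact: idealMl].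
(* For each generator [g] in turn, the element is multiplied by the largest power of [g] that keeps
   it outside [C c]. *)
have [y ny sy] : exists2 y, ~ C c y & forall g, g \in s -> C c (g * y).
  elim: s sJ {sgen} => [|g s IH] sJ; first by exists 1.
  have [|y ny sy] := IH; first by move=> x xs; apply: sJ; rewrite inE xs orbT.
  have [k Ik] := Inil g (sJ g (mem_head _ _)).
  have exk : exists k, `[< C c (g ^+ k * y) >].
    by exists k; apply/asboolP => b _; rewrite mulrCA mulrC; apply: IZ.
  case: (ex_minnP exk) => -[|j] /asboolP Cj jmin; first by rewrite mul1r in Cj.
  exists (g ^+ j * y) => [Cy|x]; first by have := jmin j (asboolT Cy); rewrite ltnn.
  rewrite inE => /predU1P[->|/sy xC]; first by rewrite mulrA -exprS.
  by rewrite mulrCA; exact: (CZ (g ^+ j)).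
(* Since [J] multiplies [y] into [C c], the element [y] lies in [C c.+1], and the chain is stable
   from [c] on. *)
apply: ny; apply: (cP c.+1) => _ /asboolP[u uP ->].
rewrite mulr_suml big_seq; apply: (submod_sum _ Is) => p pu.
have /andP[p1 p2] := allP uP p pu.
rewrite mulrAC mulrC; apply: (_ : C c (p.1 * y)) => //.
have := sgen (fun g => C c (g * y)); apply=> //.
split=> [|a b Ca Cb|a b _ Cb]; first by rewrite mul0r.
  by rewrite mulrDl; apply: CD.
by rewrite -[a *: b]/(a * b) -mulrA; apply: CZ.
Qed.

(* Weak Artin-Rees: [Q] is maximal among the submodules that meet [W] inside
   [N].  For [g] in [J] the chain [(Q : g^i)] stabilizes at some [c], and then
   [g^c M + Q] still meets [W] inside [N], so that [g^c M] lies in [Q]. *)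
Lemma weak_artin_rees (M : lmodType S) (W N : M -> Prop) :
  noeth (M := M) (fun=> True) (fun=> True) ->
  submod (fun=> True) W -> submod (fun=> True) N -> (forall x, N x -> W x) ->
  (forall g, g \in J -> exists k, forall w, W w -> N (g ^+ k *: w)) ->
  exists m, exists Q : M -> Prop, [/\ submod (fun=> True) Q,
    forall x, Q x -> W x -> N x
  & forall a, a \in ideal_pow J m -> forall x, Q (a *: x)].
Proof.
move=> nM [W0 WD WZ] Ns NW gN.
pose F (Q : M -> Prop) := [/\ submod (fun=> True) Q, forall x, N x -> Q x
  & forall x, Q x -> W x -> N x].
have [Q|//|Q [Qs NQ QW] Qmax] := noeth_max (F := F) (Q0 := N) nM.
  by case.
case: (Qs) => Q0 QD QZ.
have Qnil g : g \in J -> exists k, forall x, Q (g ^+ k *: x).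
  move=> gJ; have [k gk] := gN g gJ.
  have [i|//|i x Qx|c cP] := noeth_chain (Q := fun i x => Q (g ^+ i *: x)) nM.
  - split=> [|x y Qx Qy|a x _ Qx]; first by rewrite scaler0.
      by rewrite scalerDr; apply: QD.
    by rewrite scalerA mulrC -scalerA; apply: QZ.
  - by rewrite exprS -scalerA; apply: QZ.
  exists c => x.
  apply: (Qmax (fun z => exists x q, Q q /\ z = g ^+ c *: x + q)); last first.
  - by exists x, 0; rewrite addr0.
  - by move=> q Qq; exists 0, q; rewrite scaler0 add0r.
  split.
  - split=> [|_ _ [x1 [q1 [Q1 ->]]] [x2 [q2 [Q2 ->]]]|a _ _ [x1 [q1 [Q1 ->]]]].
    + by exists 0, 0; rewrite scaler0 addr0.
    + exists (x1 + x2), (q1 + q2); split; first exact: QD.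
      by rewrite scalerDr addrACA.
    + exists (a *: x1), (a *: q1); split; first exact: QZ.
      by rewrite scalerDr !scalerA mulrC.
  - by move=> z Nz; exists 0, z; rewrite scaler0 add0r; split=> //; apply: NQ.
  - move=> z [y [q [Qq ->]]] Wz; apply: QW => //; apply: QD => //.
    (* With [z = g ^+ c *: y + q] in [W], the multiple [g ^+ k *: z] lies in [N], hence in [Q]. So
       [g ^+ (k + c)] carries [y] into [Q], and by stability [g ^+ c] does. *)
    apply: (cP (k + c)%N); rewrite exprD -scalerA.
    rewrite -[_ *: (_ *: y)](addrK (g ^+ k *: q)) -scalerDr.
    apply: (submodB Qs) => //; last exact: QZ.
    exact/NQ/gk.
have [||m mP] := @ideal_pow_sub_nil (fun a => forall x, Q (a *: x)).
- split=> [x|a b Qa Qb x|a b _ Qb x]; first by rewrite scale0r.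
    by rewrite scalerDl; apply: QD.
  by rewrite -scalerA; apply: QZ.
- exact: Qnil.
by exists m, Q.
Qed.

(** Weak Artin-Rees is applied to the row space [W] and to the image [U] of the rows with entries in
    [J^k]. A row with entries in [J^m] lies in [Q], being a sum of multiples of unit vectors by
    elements of [J^m]. *)
Lemma artin_rees_rowspace r N (C : 'M[S]_(r, N)) k :
  exists m, forall b : 'rV[S]_r,
    (forall i, (b *m C) 0 i \in ideal_pow J m) ->
    exists2 b' : 'rV[S]_r, (forall j, b' 0 j \in ideal_pow J k)
    & b' *m C = b *m C.
Proof.
pose W x := exists b : 'rV[S]_r, x = b *m C.
pose U x := exists2 b : 'rV[S]_r, (forall j, b 0 j \in ideal_pow J k) & x = b *m C.
have [||_ [b _ ->]|g gJ|m [Q [[Q0 QD QZ] QU Qm]]] :=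
    weak_artin_rees (W := W) (N := U) (@noeth_row S nS N).
- split=> [|_ _ [b ->] [b' ->]|a _ _ [b ->]]; first by exists 0; rewrite mul0mx.
    by exists (b + b'); rewrite mulmxDl.
  by exists (a *: b); rewrite scalemxAl.
- split=> [|_ _ [b bk ->] [b' b'k ->]|a _ _ [b bk ->]].
  + by exists 0; [move=> j; rewrite mxE ideal0|rewrite mul0mx].
  + by exists (b + b'); [move=> j; rewrite mxE idealD|rewrite mulmxDl].
  + by exists (a *: b); [move=> j; rewrite mxE idealMl|rewrite scalemxAl].
- by exists b.
- exists k => _ [b ->]; exists (g ^+ k *: b); last by rewrite scalemxAl.
  by move=> j; rewrite mxE mulrC idealMl // ideal_powX.
exists m => b bm; have [||b' b'k bb'] := QU (b *m C); last by exists b'.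
  rewrite [b *m C]row_sum_delta.
  by apply: (submod_sum (P := fun=> True)) => // i _; apply: Qm.
by exists b.
Qed.

End ArtinRees.

(** * Flatness of the completion in equational form *)

Section CompletionFlat.
Variables (S : comPzRingType) (J : ideal S).
Hypothesis nS : noeth (M := S^o) (fun=> True) (fun=> True).
Local Notation Shat := (completion J).
Local Notation of_ := (compl_of J).

Lemma compl_limit (s : nat -> S) :
  (forall k, s k.+1 - s k \in ideal_pow J k) ->
  exists x : Shat, forall k, x k = toquo _ (s k).
Proof.
move=> sS; have sle i k : (i <= k)%N -> s k - s i \in ideal_pow J i.
  elim: k => [|k IH]; first by rewrite leqn0 => /eqP ->; rewrite subrr ideal0.
  rewrite leq_eqVlt => /predU1P[->|ik]; first by rewrite subrr ideal0.
  rewrite -[s k.+1](subrK (s k)) -addrA; apply: idealD; last exact: IH.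
  exact: ideal_pow_le (sS k).
have opP k : exists t, forall i, (i <= k)%N ->
    toquo (ideal_pow J i) (s i) = toquo _ t.
  by exists (s k) => i ik; apply/esym/toquoP/sle.
by exists (compl_lift0 opP).
Qed.

Lemma compl_proj_sum I (r : seq I) (p : pred I) (F : I -> Shat) k :
  (\sum_(i <- r | p i) F i) k = \sum_(i <- r | p i) F i k.
Proof.
have proj0 : (0 : Shat) k = 0 by exact: rmorph0.
by elim/big_rec2: _ => // i y z _ <-.
Qed.

(** The row space over the completion is closed: Artin-Rees lets the coefficient rows of successive
    approximations be chosen as a Cauchy sequence. *)
Lemma compl_rowspace r N (C : 'M[S]_(r, N)) (v : 'rV[Shat]_N) :
  (forall k, exists b : 'rV[S]_r, forall i, v 0 i k = toquo _ ((b *m C) 0 i)) ->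
  exists a : 'rV[Shat]_r, v = a *m map_mx of_ C.
Proof.
move=> vC; have /choice[mu muP] := artin_rees_rowspace J nS C.
(* This level is nondecreasing in [k] and at least both [k] and [mu k]. *)
pose m k := (k + \sum_(i < k.+1) mu i)%N.
pose P k (b : 'rV[S]_r) := forall i, v 0 i (m k) = toquo _ ((b *m C) 0 i).
have [b0 b0P] := vC (m 0%N).
have [k b bP|u uP] := @dependent_choice_nat _ P
    (fun k b b' => forall j, b' 0 j - b 0 j \in ideal_pow J k) b0 b0P.
  have [b1 b1P] := vC (m k.+1).
  have [i|d dk dC] := muP k (b1 - b).
    rewrite mulmxBl [X in X \in _]mxE [X in _ + X]mxE.
    apply: (@ideal_pow_le _ _ _ (m k)).
      by rewrite /m big_ord_recr /= addnA leq_addl.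
    apply/toquoP; rewrite -bP; apply/esym/(compl_proj_le _ (b1P i)).
    by rewrite /m [X in (_ <= _ + X)%N]big_ord_recr /= addSn leqW // leq_add2l leq_addr.
  (* The row [d] is small and has the same image as [b1 - b], so [b + d] is close to [b] and
     approximates [v] as well as [b1] does. *)
  exists (b + d) => [i|j]; last by rewrite mxE addrAC subrr add0r.
  by rewrite mulmxDl dC mulmxBl addrCA subrr addr0.
have /choice[a aP] j : exists x : Shat, forall k, x k = toquo _ (u k 0 j).
  by apply: compl_limit => k; have [_ ] := uP k; apply.
exists (\row_j a j); apply/rowP => i; apply: compl_ext => k.
have [uk _] := uP k; rewrite (compl_proj_le _ (uk i)) ?leq_addr //.
rewrite !mxE compl_proj_sum rmorph_sum; apply: eq_bigr => j _.
by rewrite !mxE compl_projM aP rmorphM.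
Qed.

(** The rows of [C] generate the kernel of [E] over [S]; it remains to approximate [v] by elements
    of that kernel and to apply [compl_rowspace]. *)
Lemma compl_flat N m (E : 'M[S]_(N, m)) (v : 'rV[Shat]_N) :
  v *m map_mx of_ E = 0 ->
  exists r (a : 'rV[Shat]_r) (C : 'M[S]_(r, N)),
    C *m E = 0 /\ v = a *m map_mx of_ C.
Proof.
move=> vE0.
have [||s sE sgen] := noeth_row nS (Q := fun w : 'rV[S]_N => w *m E = 0).
- split=> [|x y x0 y0|a x _ x0]; first by rewrite mul0mx.
    by rewrite mulmxDl x0 y0 addr0.
  by rewrite -scalemxAl x0 scaler0.
- by [].
pose C := \matrix_(i < size s) s`_i.
have CE : C *m E = 0.
  apply/row_matrixP => i; rewrite row_mul rowK row0; apply: sE.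
  exact: mem_nth.
have kerE w : w *m E = 0 -> exists b : 'rV[S]_(size s), w = b *m C.
  apply: (sgen (fun w => exists b, w = b *m C)) => [|x /(nthP 0)[i si <-]].
    split=> [|_ _ [b ->] [b' ->]|a _ _ [b ->]]; first by exists 0; rewrite mul0mx.
      by exists (b + b'); rewrite mulmxDl.
    by exists (a *: b); rewrite scalemxAl.
  by exists (delta_mx 0 (Ordinal si)); rewrite -rowE rowK.
suff [a va] : exists a, v = a *m map_mx of_ C by exists (size s), a, C.
apply: compl_rowspace => k; have [p pP] := artin_rees_rowspace J nS E k.
have /choice[y yP] i : exists t, forall l, (l <= maxn k p)%N -> v 0 i l = toquo _ t.
  exact: compl_approx.
(* The approximation [y] of [v] has image under [E] in [J^p]. Subtracting a row [u] over [J^k] with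
   the same image gives a true kernel element, still congruent to [v] modulo [J^k]. *)
have [j|u uk uE] := pP (\row_i y i).
  rewrite -[X in X \in _]subr0; apply/toquoP; rewrite rmorph0.
  transitivity ((v *m map_mx of_ E) 0 j p); last by rewrite vE0 mxE; apply: rmorph0.
  rewrite !mxE compl_proj_sum rmorph_sum; apply: eq_bigr => i _.
  by rewrite !mxE compl_projM (yP i) ?leq_maxr // rmorphM.
have [b yb] : exists b, \row_i y i - u = b *m C.
  by apply: kerE; rewrite mulmxBl uE subrr.
exists b => i; rewrite -yb (yP i) ?leq_maxl //; apply/toquoP.
by rewrite !mxE opprB addrC subrK.
Qed.

End CompletionFlat.

(** * Operators with values in an [S]-algebra, and their determination by finitely many values *)

Section RelativeDiffOps.
Variables (A S T : comPzRingType) (f : {rmorphism A -> S}) (c : {rmorphism S -> T}).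
Implicit Types (d : S -> T).

Definition rcommutator d (s : S) : S -> T := fun x => d (s * x) - c s * d x.

(** With [T] the completion, this covers the restrictions to [S] of operators on it; with [c] the
    identity it is [is_diffop]. *)
Fixpoint rdiffop (n : nat) d : Prop :=
  if n is m.+1 then
    (forall a x y, d (f a * x + y) = c (f a) * d x + d y) /\
    forall s, rdiffop m (rcommutator d s)
  else forall s x y, d (s * x + y) = c s * d x + d y.

Lemma rdiffop_hom n d a x y :
  rdiffop n d -> d (f a * x + y) = c (f a) * d x + d y.
Proof. by case: n => [dP|n [dP _]]; apply: dP. Qed.

Lemma rdiffop_add n d : rdiffop n d -> {morph d : x y / x + y}.
Proof. by move=> dP x y; have := rdiffop_hom 1 x y dP; rewrite !rmorph1 !mul1r. Qed.

Lemma rdiffop_zero n d : rdiffop n d -> d 0 = 0.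
Proof. by move=> /rdiffop_add dD; apply: (addIr (d 0)); rewrite -dD !add0r. Qed.

Section Combinations.
Variables (n : nat) (e : seq S).

(* [phi] is an S-linear combination of the values at the elements of [e],
   uniformly for all operators of order at most [n]. *)
Definition combination (phi : (S -> T) -> T) : Prop :=
  exists w : nat -> S, forall d, rdiffop n d ->
    phi d = \sum_(i < size e) c (w i) * d e`_i.

Lemma combination_ext phi psi :
  (forall d, rdiffop n d -> phi d = psi d) -> combination phi -> combination psi.
Proof. by move=> eqp [w wP]; exists w => d dP; rewrite -eqp // wP. Qed.

Lemma combination_lin s phi psi : combination phi -> combination psi ->
  combination (fun d => c s * phi d + psi d).
Proof.
move=> [w wP] [v vP]; exists (fun i => s * w i + v i) => d dP.
rewrite wP // vP // mulr_sumr -big_split; apply: eq_bigr => i _.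
by rewrite rmorphD rmorphM mulrDl mulrA.
Qed.

Lemma combination0 : combination (fun=> 0).
Proof. by exists (fun=> 0) => d _; rewrite big1 // => i _; rewrite rmorph0 mul0r. Qed.

Lemma combinationZ s phi : combination phi -> combination (fun d => c s * phi d).
Proof.
move=> cphi; apply: combination_ext (combination_lin s cphi combination0) => d _.
by rewrite addr0.
Qed.

Lemma combinationD phi psi : combination phi -> combination psi ->
  combination (fun d => phi d + psi d).
Proof.
move=> cphi cpsi; apply: combination_ext (combination_lin 1 cphi cpsi) => d _.
by rewrite rmorph1 mul1r.
Qed.

Lemma combinationN phi : combination phi -> combination (fun d => - phi d).
Proof.
move=> /(combinationZ (-1)); apply: combination_ext => d _.
by rewrite rmorphN rmorph1 mulN1r.
Qed.

Lemma combination_sum k (w : nat -> S) (phi : nat -> (S -> T) -> T) :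
  (forall i, (i < k)%N -> combination (phi i)) ->
  combination (fun d => \sum_(i < k) c (w i) * phi i d).
Proof.
elim: k => [|k IH] phiP.
  by apply: combination_ext combination0 => d _; rewrite big_ord0.
apply: combination_ext (combinationD (IH _) (combinationZ (w k) (phiP k _))) => //.
  by move=> d _; rewrite big_ord_recr.
by move=> i ik; apply: phiP; rewrite ltnS ltnW.
Qed.

Lemma combination_mem s : s \in e -> combination (fun d => d s).
Proof.
move=> /(nthP 0)[i ie <-]; exists (fun j => (j == i)%:R) => d _.
rewrite (bigD1 (Ordinal ie)) //= eqxx rmorph1 mul1r big1 ?addr0 // => j ji.
by rewrite -[_ == i]/(j == Ordinal ie) (negPf ji) rmorph0 mul0r.
Qed.

End Combinations.

Definition generates n (e : seq S) : Prop :=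
  forall s, combination n e (fun d => d s).

(** By induction on the order: a commutator with [x] has lower order, so it is determined by its
    values at [e], which involve only [d (x * y)] and [d y] for [y] in [e]. *)
Lemma rdiffop_generators n : ess_finite_type f -> exists e, generates n e.
Proof.
move=> [B [g [h [M [[gens gensP] _ [hu hs _] fgh]]]]].
elim: n => [|n [e eP]].
  exists [:: 1] => s; exists (fun=> s) => d dP; rewrite big_ord1 /=.
  by have := dP s 1 0; rewrite mulr1 (rdiffop_zero (n := 0) dP) !addr0.
(* The products [h x * y] make the commutators with the algebra generators computable, whence [G] is
   stable under multiplication by the image of [B]. *)
pose e1 := 1 :: e ++ [seq h x * y | x <- gens, y <- e].
pose G s := combination n.+1 e1 (fun d => d s).
have Ge s : s \in e -> G s.
  by move=> se; apply: combination_mem; rewrite inE mem_cat se orbT.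
have comm x t : (forall y, y \in e -> G (x * y)) ->
    combination n.+1 e1 (fun d => rcommutator d x t).
  move=> xe; have [w wP] := eP t.
  apply: (@combination_ext _ _
    (fun d => \sum_(i < size e) c (w i) * rcommutator d x e`_i)).
    by move=> d [_ dP]; rewrite (wP _ (dP x)).
  apply: (@combination_sum _ _ _ _ (fun i d => rcommutator d x e`_i)) => i ie.
  apply: combinationD; first exact/xe/mem_nth.
  exact/combinationN/combinationZ/Ge/mem_nth.
have GM x t : (forall y, y \in e -> G (x * y)) -> G t -> G (x * t).
  move=> xe Gt; apply: combination_ext (combination_lin x Gt (comm x t xe)).
  by move=> d _; rewrite addrC subrK.
have GD s t : G s -> G t -> G (s + t).
  move=> Gs Gt; apply: combination_ext (combinationD Gs Gt) => d dP.
  by rewrite (rdiffop_add dP).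
have GB : forall b t, G t -> G (h b * t).
  apply: (gensP (fun b => forall t, G t -> G (h b * t))) =>
    [a t Gt|b bg t Gt|x y IHx IHy t Gt|x y IHx IHy t Gt].
  - apply: combination_ext (combinationZ (f a) Gt) => d dP.
    by rewrite -fgh -[f a * t]addr0 (rdiffop_hom _ _ _ dP) (rdiffop_zero dP) addr0.
  - apply: GM => // y ye; apply: combination_mem.
    by rewrite inE mem_cat (allpairs_f (fun x y => h x * y)) ?orbT.
  - by rewrite rmorphD mulrDl; apply: GD; [exact: IHx|exact: IHy].
  - by rewrite rmorphM -mulrA; apply/IHx/IHy.
have G1 : G 1 by apply: combination_mem; rewrite mem_head.
exists e1 => s; have [b [m [Mm sm]]] := hs s; have [u um] := hu m Mm.
have Gb : G (h b) by rewrite -[h b]mulr1; apply: GB.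
have me y : y \in e -> G (h m * y) by move=> /Ge; apply: GB.
(* For a fraction [s] with [s * h m = h b], the value [d s] is [u] times the difference of [d (h b)]
   and the commutator of [d] with [h m] at [s]. *)
apply: combination_ext
  (combinationZ u (combinationD Gb (combinationN (comm (h m) s me)))) => d _.
rewrite /rcommutator -sm [s * _]mulrC opprB addrC subrK mulrA -rmorphM um.
by rewrite rmorph1 mul1r.
Qed.

End RelativeDiffOps.

(** * Operators rebuilt from their value vectors *)

Section Values.
Variables (A S : comPzRingType) (f : {rmorphism A -> S}).

Lemma diffop_sumE n I (r : seq I) (p : pred I) (F : I -> diffop f n) s :
  (\sum_(i <- r | p i) F i) s = \sum_(i <- r | p i) F i s.
Proof. by elim/big_rec2: _ => // i y z _ <-. Qed.

Lemma diffops_sumE I (r : seq I) (p : pred I) (F : I -> diffops f) s :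
  (\sum_(i <- r | p i) F i) s = \sum_(i <- r | p i) F i s.
Proof. by elim/big_rec2: _ => // i y z _ <-. Qed.

Lemma is_diffopE n (d : S -> S) : is_diffop f n d <-> rdiffop f idfun n d.
Proof.
elim: n d => [|n IH] d //=.
by split=> -[dP dQ]; split=> // s; apply/IH; apply: dQ.
Qed.

End Values.

Section Decomposition.
Variables (A S T : comPzRingType) (f : {rmorphism A -> S}) (c : {rmorphism S -> T}).
Variables (n : nat) (e : seq S).
Local Notation N := (size e).

Definition eval_row (d : S -> T) (w : 'rV[S]_N) : T :=
  \sum_(i < N) c (w 0 i) * d e`_i.

Lemma eval_row_lin d a w w' :
  eval_row d (a *: w + w') = c a * eval_row d w + eval_row d w'.
Proof.
rewrite mulr_sumr -big_split; apply: eq_bigr => i _ /=.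
by rewrite !mxE rmorphD rmorphM mulrDl mulrA.
Qed.

(* The relations are those of all [T]-valued operators: this replaces the
   module of principal parts. *)
Definition kills_relations (v : 'rV[S]_N) : Prop :=
  forall w, (forall d, rdiffop f c n d -> eval_row d w = 0) ->
  \sum_(i < N) w 0 i * v 0 i = 0.

(** Each identity defining an operator of order [m] is a linear relation on the values at [e], valid
    for all [d]; since [v] respects these relations, the identity passes to [v]. For the
    commutators, [W] is replaced by [W']. *)
Lemma is_diffop_of_row (v : 'rV[S]_N) m (W : S -> 'rV[S]_N) :
  kills_relations v ->
  (forall d, rdiffop f c n d -> rdiffop f c m (fun s => eval_row d (W s))) ->
  is_diffop f m (fun s => \sum_(i < N) W s 0 i * v 0 i).
Proof.
move=> vP; pose pr (w : 'rV[S]_N) := \sum_(i < N) w 0 i * v 0 i.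
have prlin a w w' : pr (a *: w + w') = a * pr w + pr w'.
  rewrite mulr_sumr -big_split; apply: eq_bigr => i _ /=.
  by rewrite !mxE mulrDl mulrA.
have key w w' : (forall d, rdiffop f c n d -> eval_row d w = eval_row d w') ->
    pr w = pr w'.
  move=> ww'; apply/eqP; rewrite -subr_eq0; apply/eqP.
  have -> : pr w - pr w' = pr ((-1) *: w' + w) by rewrite prlin mulN1r addrC.
  by apply: vP => d dP; rewrite eval_row_lin rmorphN rmorph1 mulN1r ww' // addNr.
have homW a x y : (forall d, rdiffop f c n d -> eval_row d (W (a * x + y)) =
    c a * eval_row d (W x) + eval_row d (W y)) ->
    pr (W (a * x + y)) = a * pr (W x) + pr (W y).
  by move=> Wg; rewrite -prlin; apply: key => d dP; rewrite Wg // eval_row_lin.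
elim: m W homW => [|m IH] W homW WP.
  by move=> a x y; apply: homW => d dP; apply: WP.
split=> [a x y|s]; first by apply: homW => d /WP[dP _]; apply: dP.
pose W' x := (- s) *: W x + W (s * x).
rewrite (_ : commutator _ s = fun x => pr (W' x)); last first.
  by apply/funext => x; rewrite prlin mulNr addrC.
apply: IH => [a x y W'g|d /WP[_ /(_ s)]].
  by rewrite -prlin; apply: key => d dP; rewrite W'g // eval_row_lin.
congr rdiffop; apply/funext => x.
by rewrite eval_row_lin rmorphN mulNr addrC.
Qed.

Hypothesis egen : generates f c n e.

Lemma generators_row : exists W : S -> 'rV[S]_N,
  forall d s, rdiffop f c n d -> d s = eval_row d (W s).
Proof.
have /choice[W WP] s : exists w : 'rV[S]_N,
    forall d, rdiffop f c n d -> d s = eval_row d w.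
  have [w wP] := egen s; exists (\row_i w i) => d /wP ->.
  by apply: eq_bigr => i _; rewrite mxE.
by exists W => d s; apply: WP.
Qed.

End Decomposition.

(** * Linear relations in tensor products *)

Section TensorSums.
Variables (R T : comPzRingType) (c : {rmorphism R -> T}) (N : lmodType R).

Lemma pureDl a b (x : N) : pure c (a + b) x = pure c a x + pure c b x.
Proof. by rewrite [RHS]tensor_addE; apply/tensor_classP/tensor_addl. Qed.

Lemma pureDr a (x y : N) : pure c a (x + y) = pure c a x + pure c a y.
Proof. by rewrite [RHS]tensor_addE; apply/tensor_classP/tensor_addr. Qed.

Lemma pure_bal a r (x : N) : pure c (a * c r) x = pure c a (r *: x).
Proof. exact/tensor_classP/tensor_bal. Qed.

Lemma pure0l (x : N) : pure c 0 x = 0.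
Proof. exact/tensor_classP/tensor_zero. Qed.

Lemma pure0r a : pure c a (0 : N) = 0.
Proof. by rewrite -(scale0r 0) -pure_bal rmorph0 mulr0 pure0l. Qed.

(** The easy half of the equational criterion for vanishing: the entries of [C] are moved across the
    tensor sign. *)
Lemma pure_sum_relations p q (x : 'I_p -> N) (b : 'rV[T]_q) (C : 'M[R]_(q, p)) :
  (forall j, \sum_i C j i *: x i = 0) ->
  \sum_i pure c ((b *m map_mx c C) 0 i) (x i) = 0.
Proof.
move=> Cx.
have suml i : pure c ((b *m map_mx c C) 0 i) (x i) =
    \sum_j pure c (b 0 j) (C j i *: x i).
  rewrite mxE (big_morph (fun a => pure c a (x i)) (fun a b => pureDl a b _) (pure0l _)).
  by apply: eq_bigr => j _; rewrite mxE pure_bal.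
under eq_bigr do rewrite suml.
rewrite exchange_big big1 // => j _.
by rewrite -(big_morph _ (pureDr (b 0 j)) (pure0r _)) Cx pure0r.
Qed.

End TensorSums.

(** * Operators on the completion and their restrictions to [S] *)

Section CompletedDiffOps.
Variables (A S : comPzRingType) (f : {rmorphism A -> S}) (J : ideal S).
Hypothesis nS : noeth (M := S^o) (fun=> True) (fun=> True).
Local Notation Shat := (completion J).
Local Notation of_ := (compl_of J).

(** At every level [x] is approximated by elements of [J^k], that is, by the row space of a column
    of generators of [J^k]; this row space is closed over the completion. *)
Lemma compl_kernel (x : Shat) k : x k = 0 ->
  exists r (a : 'I_r -> Shat) (g : 'I_r -> S),
    (forall j, g j \in ideal_pow J k) /\ x = \sum_j a j * of_ (g j).
Proof.
move=> xk0.
have [||s sJ sgen] := nS (Q := fun g : S => g \in ideal_pow J k).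
- by split=> [|y z yJ zJ|a y _ yJ]; [exact: ideal0|exact: idealD|exact: idealMl].
- by [].
pose C : 'M[S]_(size s, 1) := \col_i s`_i.
have [l|a xa] := compl_rowspace nS (C := C) (v := const_mx x).
  have [t xt] := compl_approx x (maxn k l).
  have tJ : t \in ideal_pow J k.
    rewrite -[t]subr0; apply/toquoP; rewrite rmorph0 -xk0 xt //.
    exact: leq_maxl.
  have [b tb] : exists b : 'rV[S]_(size s), t = (b *m C) 0 0.
    apply: (sgen (fun t => exists b : 'rV[S]_(size s), t = (b *m C) 0 0)) tJ.
      split=> [|_ _ [b ->] [b' ->]|r _ _ [b ->]].
      - by exists 0; rewrite mul0mx mxE.
      - by exists (b + b'); rewrite mulmxDl [RHS]mxE.
      - by exists (r *: b); rewrite -scalemxAl [RHS]mxE.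
    move=> y /(nthP 0)[i si <-]; exists (delta_mx 0 (Ordinal si)).
    by rewrite -rowE !mxE.
  by exists b => i; rewrite mxE ord1 -tb xt ?leq_maxr.
exists (size s), (a 0), (fun j => s`_j); split=> [j|]; first exact/sJ/mem_nth.
have /rowP/(_ 0) := xa; rewrite !mxE => ->.
by apply: eq_bigr => j _; rewrite !mxE.
Qed.

Lemma linear_restrict_eq0 (F : Shat -> Shat) :
  {morph F : x y / x + y} -> (forall s x, F (of_ s * x) = of_ s * F x) ->
  (forall s, F (of_ s) = 0) -> F = fun=> 0.
Proof.
move=> FD FS F0; apply/funext => x; apply: compl_ext => k.
have [t xt] := compl_approx x k.
have [|r [a [g [gJ xg]]]] := compl_kernel (x := x - of_ t) (k := k).
  by rewrite compl_projD compl_projN xt // subrr.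
have F00 : F 0 = 0 by have := F0 0; rewrite rmorph0.
rewrite -[x](subrK (of_ t)) FD F0 addr0 xg (big_morph F FD F00) compl_proj_sum.
rewrite big1 => [|j _]; first exact/esym/rmorph0.
rewrite mulrC FS compl_projM compl_proj_of.
rewrite (_ : toquo _ _ = 0) ?mul0r //.
by rewrite -(rmorph0 (toquo _)); apply/toquoP; rewrite subr0.
Qed.

Lemma diffop_restrict_eq0 n (F : Shat -> Shat) :
  is_diffop (compl_alg f J) n F -> (forall s, F (of_ s) = 0) -> F = fun=> 0.
Proof.
elim: n F => [|n IH] F FP F0; have FD := homD (is_diffop_hom FP).
  apply: linear_restrict_eq0 => // s x.
  exact: (@homM _ _ idfun _ FP).
apply: linear_restrict_eq0 => // s x; apply/eqP; rewrite -subr_eq0; apply/eqP.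
have [_ /(_ (of_ s)) FQ] := FP.
suff /(congr1 (@^~ x)) : commutator F (of_ s) = fun=> 0 by [].
by apply: IH => // t; rewrite /commutator -rmorphM !F0 mulr0 subrr.
Qed.

Lemma rdiffop_restrict n (F : Shat -> Shat) :
  is_diffop (compl_alg f J) n F -> rdiffop f of_ n (F \o of_).
Proof.
elim: n F => [|n IH] F /=.
  by move=> FP s x y /=; rewrite rmorphD rmorphM FP.
move=> [FP FQ]; split=> [a x y|s]; first by rewrite rmorphD rmorphM FP.
have := IH _ (FQ (of_ s)); congr rdiffop; apply/funext => x.
by rewrite /= /commutator /rcommutator -rmorphM.
Qed.

Hypothesis hS : ess_finite_type f.

Lemma rdiffop_decompose n (F : S -> Shat) : rdiffop f of_ n F ->
  exists r (a : 'I_r -> Shat) (d : 'I_r -> diffop f n),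
    forall s, F s = \sum_j a j * of_ (d j s).
Proof.
move=> FP; have [e egen] := rdiffop_generators of_ n hS.
have [W WP] := generators_row egen.
have e0 (d : S -> Shat) : eval_row of_ d (0 : 'rV[S]_(size e)) = 0.
  by rewrite /eval_row big1 // => i _; rewrite mxE rmorph0 mul0r.
have [||ks kP kgen] := noeth_row nS (Q := fun w : 'rV[S]_(size e) =>
    forall d, rdiffop f of_ n d -> eval_row of_ d w = 0).
- split=> [d _|w w' w0 w'0 d dP|a w _ w0 d dP].
  + exact: e0.
  + by rewrite -[w]scale1r eval_row_lin w0 // w'0 // mulr0 addr0.
    by rewrite -[_ *: _]addr0 eval_row_lin w0 // e0 mulr0 addr0.
- by [].
pose E : 'M[S]_(size e, size ks) := \matrix_(i, j) ks`_j 0 i.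
pose v : 'rV[Shat]_(size e) := \row_i F e`_i.
(* The columns of [E] generate the relations among values, so the value vector [v] of [F] is killed
   by [E]. Flatness writes it through rows over [S] that are killed too and hence come from
   operators on [S]. *)
have [|r [a [C [CE va]]]] := compl_flat nS (E := E) (v := v).
  apply/rowP => j; rewrite !mxE -[RHS](kP ks`_j (mem_nth _ (ltn_ord j)) F FP).
  by apply: eq_bigr => i _; rewrite !mxE mulrC.
have Ckills j : kills_relations f of_ n (row j C).
  move=> w; apply: (kgen (fun w => \sum_i w 0 i * row j C 0 i = 0)).
    split=> [|x y x0 y0|b x _ x0].
    - by rewrite big1 // => i _; rewrite mxE mul0r.
    - under eq_bigr do rewrite mxE mulrDl.
      by rewrite big_split /= x0 y0 addr0.
    - under eq_bigr do rewrite mxE -mulrA.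
      by rewrite -mulr_sumr x0 mulr0.
  move=> _ /(nthP 0)[l lk <-].
  have /matrixP/(_ j (Ordinal lk)) := CE; rewrite !mxE => CE0.
  by rewrite -[RHS]CE0; apply: eq_bigr => i _; rewrite !mxE mulrC.
pose d j s := \sum_i W s 0 i * row j C 0 i.
have dP j : is_diffop f n (d j).
  apply: (is_diffop_of_row (Ckills j)) => g gP.
  (* Rebuilding [g] from its values at [e] gives back [g], which has order [n] by assumption. *)
  rewrite (_ : (fun s => _) = g) //.
  by apply/funext => s; rewrite -WP.
exists r, (a 0), (fun j => DiffOp (introT (asboolP _) (dP j))) => s.
rewrite (WP F s FP) /eval_row /=.
under [RHS]eq_bigr => j _.
  rewrite rmorph_sum mulr_sumr; over.
rewrite exchange_big; apply: eq_bigr => i _ /=.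
have /rowP/(_ i) := va; rewrite !mxE => ->.
rewrite mulr_sumr; apply: eq_bigr => j _.
by rewrite !mxE rmorphM mulrCA.
Qed.

(** Flatness is applied to the finite matrix of values at [e]; a combination of the [d i] that
    vanishes on [e] vanishes everywhere. *)
Lemma hat_relations n p (d : 'I_p -> S -> S) (a : 'rV[Shat]_p) :
  (forall i, is_diffop f n (d i)) ->
  (forall s, \sum_i a 0 i * of_ (d i s) = 0) ->
  exists q (b : 'rV[Shat]_q) (C : 'M[S]_(q, p)),
    (forall j s, \sum_i C j i * d i s = 0) /\ a = b *m map_mx of_ C.
Proof.
move=> dP ad0; have [e egen] := rdiffop_generators (@idfun S) n hS.
pose E : 'M[S]_(p, size e) := \matrix_(i, j) d i e`_j.
have [|q [b [C [CE ab]]]] := compl_flat nS (E := E) (v := a).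
  apply/rowP => j; rewrite !mxE -[RHS](ad0 e`_j).
  by apply: eq_bigr => i _; rewrite !mxE.
exists q, b, C; split=> // j s.
pose D : diffop f n := \sum_i C j i *: DiffOp (introT (asboolP _) (dP i)).
have DE t : D t = \sum_i C j i * d i t by rewrite diffop_sumE.
rewrite -DE; have [w wP] := egen s.
rewrite (wP D) ?big1 // => [i _|]; last exact/is_diffopE/diffopP.
have /matrixP/(_ j i) := CE; rewrite !mxE => CE0.
rewrite DE (_ : \sum_(_ < p) _ = 0) ?mulr0 // -[RHS]CE0.
by apply: eq_bigr => k _; rewrite mxE.
Qed.

End CompletedDiffOps.

(** * Bijectivity of the natural maps and the ring structure *)

Lemma inj_surj_bijective (X Y : Type) (g : X -> Y) :
  injective g -> (forall y, exists x, g x = y) -> bijective g.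
Proof.
move=> g_inj /choice[h hK]; exists h => // x; exact/g_inj/hK.
Qed.

Section Assembly.
Variables (A S : comPzRingType) (f : {rmorphism A -> S}) (J : ideal S).
Hypothesis nS : noeth (M := S^o) (fun=> True) (fun=> True).
Hypothesis hS : ess_finite_type f.
Local Notation Shat := (completion J).
Local Notation of_ := (compl_of J).

Lemma diffop_decompose n (F : Shat -> Shat) : is_diffop (compl_alg f J) n F ->
  exists r (a : 'I_r -> Shat) (d : 'I_r -> diffop f n),
    forall x, F x = \sum_j a j * hat_diffop J (d j) x.
Proof.
move=> FP; have [r [a [d Fad]]] := rdiffop_decompose nS hS (rdiffop_restrict FP).
exists r, a, d => x.
pose G : diffop (compl_alg f J) n := \sum_j a j *: hat_diffop J (d j).
have GE y : G y = \sum_j a j * hat_diffop J (d j) y by rewrite diffop_sumE.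
pose F' : diffop (compl_alg f J) n := DiffOp (introT (asboolP _) FP).
(* The decomposition is known only on [S]; the difference is an operator vanishing there, hence
   zero. *)
have := @diffop_restrict_eq0 _ _ f J nS n _ (diffopP (F' - G)).
move=> /(_ _)/(congr1 (@^~ x)) /= => FG.
apply/eqP; rewrite -subr_eq0 -GE; apply/eqP; apply: FG => s.
rewrite -[_ (of_ s)]/(F (of_ s) - G (of_ s)) GE -[F _]/((F \o of_) s) Fad.
apply/eqP; rewrite subr_eq0; apply/eqP; apply: eq_bigr => j _.
by congr (_ * _); exact/esym/(hat_of J s (diffopP (d j))).
Qed.

Lemma nat_map_sum n p (a : 'I_p -> Shat) (d : 'I_p -> diffop f n) x :
  nat_map f J n (\sum_i pure of_ (a i) (d i)) x =
  \sum_i a i * hat (J := J) (d i) x.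
Proof.
rewrite raddf_sum [LHS]diffop_sumE; apply: eq_bigr => i _.
exact: (congr1 (fun F : diffop _ n => F x) (nat_map_pure (a i) (d i))).
Qed.

Lemma nat_map_all_sum p (a : 'I_p -> Shat) (d : 'I_p -> diffops f) x :
  nat_map_all f J (\sum_i pure of_ (a i) (d i)) x =
  \sum_i a i * hat (J := J) (d i) x.
Proof.
rewrite raddf_sum [LHS]diffops_sumE; apply: eq_bigr => i _.
exact: (congr1 (fun F : diffops _ => F x) (nat_map_all_pure (a i) (d i))).
Qed.

Lemma nat_map_bijective n : bijective (nat_map f J n).
Proof.
apply: inj_surj_bijective => [|F].
  apply: raddf_inj => t; rewrite [t]tensor_sum_pure big_tnth.
  set u := tensor_repr t; set p := fun i : 'I_(size u) => tnth (in_tuple u) i.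
  (* Evaluating the zero operator at elements of [S] gives a relation over the completion, which
     comes from relations over [S]; these kill the tensor. *)
  move=> t0; have [i|s|q [b [C [Cd ab]]]] := @hat_relations _ _ f J nS hS n _
      (fun i => (p i).2 : S -> S) (\row_i (p i).1).
  - exact: diffopP.
  - transitivity ((0 : diffop (compl_alg f J) n) (of_ s)) => //.
    rewrite -t0 [RHS]nat_map_sum; apply: eq_bigr => i _; rewrite mxE.
    congr (_ * _); exact/esym/(hat_of J s (diffopP (p i).2)).
  rewrite -[RHS](pure_sum_relations of_ (x := fun i => (p i).2) b (C := C)).
    by apply: eq_bigr => i _; rewrite -ab mxE.
  move=> j; apply: val_inj; apply/funext => s.
  by rewrite [LHS]diffop_sumE [LHS]Cd.
have [r [a [d Fad]]] := diffop_decompose (diffopP F).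
exists (\sum_j pure of_ (a j) (d j)); apply: val_inj; apply/funext => x.
by rewrite [LHS]nat_map_sum [RHS]Fad.
Qed.

Lemma diffops_common_order p (d : 'I_p -> diffops f) :
  exists n, forall i, is_diffop f n (d i).
Proof.
have /choice[n nP] i := diffopsP (d i).
by exists (\max_i n i) => i; apply: is_diffop_le (nP i); apply: leq_bigmax.
Qed.

Lemma diffops_decompose n (F : Shat -> Shat) : is_diffop (compl_alg f J) n F ->
  exists r (a : 'I_r -> Shat) (d : 'I_r -> diffops f),
    (forall j, is_diffop f n (d j)) /\
    forall x, F x = \sum_j a j * hat_diffops J (d j) x.
Proof.
move=> /diffop_decompose[r [a [d Fad]]].
have dP j : diffops_pred f (d j) by apply/asboolP; exists n; apply: diffopP.
by exists r, a, (fun j => DiffOps (dP j)); split=> // j; apply: diffopP.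
Qed.

Lemma nat_map_all_injective : injective (nat_map_all f J).
Proof.
apply: raddf_inj => t; rewrite [t]tensor_sum_pure big_tnth.
set u := tensor_repr t; set p := fun i : 'I_(size u) => tnth (in_tuple u) i.
(* A tensor involves finitely many operators, so the argument in a single order applies. *)
have [n nP] := diffops_common_order (fun i => (p i).2).
move=> t0; have [//|s|q [b [C [Cd ab]]]] := @hat_relations _ _ f J nS hS n _
    (fun i => (p i).2 : S -> S) (\row_i (p i).1).
  transitivity ((0 : diffops (compl_alg f J)) (of_ s)) => //.
  rewrite -t0 [RHS]nat_map_all_sum; apply: eq_bigr => i _; rewrite mxE.
  congr (_ * _); exact/esym/(hat_of J s (nP i)).
rewrite -[RHS](pure_sum_relations of_ (x := fun i => (p i).2) b (C := C)).
  by apply: eq_bigr => i _; rewrite -ab mxE.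
move=> j; apply: val_inj; apply/funext => s.
by rewrite [LHS]diffops_sumE [LHS]Cd.
Qed.

(** The order bound on the preimage serves the condition [trm_commS] on the multiplication. *)
Lemma nat_map_all_surjective n (F : diffops (compl_alg f J)) :
  is_diffop (compl_alg f J) n F ->
  exists2 t, has_order_le n t & nat_map_all f J t = F.
Proof.
move=> /diffops_decompose[r [a [d [dP Fad]]]].
exists (\sum_j pure of_ (a j) (d j)).
  exists [seq (a j, d j) | j <- enum 'I_r] => [_ /mapP[j _ ->]|].
    exact: dP.
  by rewrite big_map big_enum.
apply: val_inj; apply/funext => x.
by rewrite [LHS]nat_map_all_sum [RHS]Fad.
Qed.

Lemma nat_map_all_bijective : bijective (nat_map_all f J).
Proof.
apply: inj_surj_bijective; first exact: nat_map_all_injective.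
by move=> F; have [n /nat_map_all_surjective[t _ tF]] := diffopsP F; exists t.
Qed.

(** The composite of two continuous extensions is a continuous extension of the composite, and such
    extensions are unique. *)
Lemma hat_diffops_comp (d e : diffops f) :
  hat_diffops J (d * e) = hat_diffops J d * hat_diffops J e.
Proof.
have [m /(hatP J) dF] := diffopsP d; have [n /(hatP J) eF] := diffopsP e.
apply: val_inj; apply: hatE => k.
have [l dl] := dF k; have [l' el] := eF l; exists l' => x s xs.
by apply: dl; apply: el.
Qed.

Lemma hat_diffops1 : hat_diffops J (1 : diffops f) = 1.
Proof.
by apply: val_inj; apply: hatE => k; exists k.
Qed.

(** Composition of operators on the completion is transported along the natural bijection; each
    condition is checked after applying this injective map. *)
Lemma tensor_ring_mul_transport : exists mul,
  [/\ tensor_ring_mul mul, bijective (nat_map_all f J),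
      nat_map_all f J (pure_all f J 1 1) = 1
    & {morph nat_map_all f J : t u / mul t u >-> t * u}].
Proof.
have [psi _ psiK] := nat_map_all_bijective.
have inj := nat_map_all_injective.
pose mul t u := psi (nat_map_all f J t * nat_map_all f J u).
have mulE t u : nat_map_all f J (mul t u) = nat_map_all f J t * nat_map_all f J u.
  exact: psiK.
have natD t u : nat_map_all f J (t + u) = nat_map_all f J t + nat_map_all f J u.
  exact: raddfD.
have natB t u : nat_map_all f J (t - u) = nat_map_all f J t - nat_map_all f J u.
  exact: raddfB.
have pureE a d : nat_map_all f J (pure_all f J a d) = a *: hat_diffops J d.
  exact: nat_map_all_pure.
have one : nat_map_all f J (pure_all f J 1 1) = 1.
  by rewrite pureE hat_diffops1 scale1r.
exists mul; split=> //; last exact: nat_map_all_bijective.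
split.
- by move=> t u v; apply: inj; rewrite !mulE mulrA.
- by move=> t; apply: inj; rewrite mulE one mul1r.
- by move=> t; apply: inj; rewrite mulE one mulr1.
- by move=> t u v; apply: inj; rewrite natD !mulE natD mulrDl.
- by move=> t u v; apply: inj; rewrite natD !mulE natD mulrDr.
- move=> a t; apply: inj; rewrite mulE linearZ pureE hat_diffops1.
  by apply: val_inj.
- by move=> d e; apply: inj; rewrite mulE !pureE !scale1r hat_diffops_comp.
- move=> d a dP; apply: inj; rewrite mulE !pureE hat_diffops1 scale1r.
  apply: val_inj; apply/funext => x.
  exact: (@homM _ _ idfun _ (is_diffop_hat J dP)).
- move=> n d a dP.
  (* The difference maps to the commutator of the extended [d] with [a], of order at most [n]; by
     injectivity it equals the preimage of bounded order. *)
  have [_ /(_ a) hdP] := is_diffop_hat J dP.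
  have [|t tn tE] := @nat_map_all_surjective n
    (nat_map_all f J (mul (pure_all f J 1 d) (pure_all f J a 1) - pure_all f J a d)).
    rewrite natB mulE !pureE hat_diffops1 scale1r.
    exact: hdP.
  by have <- := inj _ _ tE.
Qed.

End Assembly.

Theorem corollary2p8 (A S : comPzRingType) (f : {rmorphism A -> S})
    (J : ideal S) (hA : noetherian A) (hS : ess_finite_type f) :
  (forall n : nat, bijective (nat_map f J n)) /\
  exists mul : tensor (compl_of J) (diffops f) ->
               tensor (compl_of J) (diffops f) ->
               tensor (compl_of J) (diffops f),
    [/\ tensor_ring_mul mul,
        bijective (nat_map_all f J),
        nat_map_all f J (pure_all f J 1 1) = 1
      & {morph nat_map_all f J : t u / mul t u >-> t * u}].
Proof.
have nS := noeth_ess_finite_type hA hS.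
split; [exact: nat_map_bijective|exact: tensor_ring_mul_transport].
Qed.
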